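(* Assume there exists $(\gamma_0^*,\gamma^* )\in\Gamma$ with $A(\gamma_0^*,\gamma^* )\succ 0$, and assume that $\Gamma$ is polyhedral. (1) For every $(x,t)\in\mathcal S_{\mathrm{SDP}}$ such that $2t=\sup_{\gamma\in\Gamma_1}[\gamma,q(x)]$, and every $f\in\mathbb R^m$ with $(1,f)\in\operatorname{rint}(\mathcal F(x,t))$, $$\mathcal R'(x,t)=\left\{(x',t')\in\mathbb R^{n+1}:\ x'\in\ker(A[f]),\ \ \langle b[\gamma],x'\rangle-t'=0\ \ \forall (1,\gamma)\in\mathcal F(x,t)\right\}.$$ (In particular the right-hand side depends on $(x,t)$ only through the face $\mathcal F(x,t)$.) (2) Consequently, $\operatorname{conv}(\mathcal S)=\mathcal S_{\mathrm{SDP}}$ if and only if for every face $\mathcal F$ of $\Gamma$ of the form $\mathcal F=\Gamma\cap(q(x)-2te_0)^\perp$ for some $(x,t)\in\mathcal S_{\mathrm{SDP}}\setminus\mathcal S$ with $2t=\sup_{\gamma\in\Gamma_1}[\gamma,q(x)]$, the set $$\left\{(x',t')\in\mathbb R^{n+1}:\ x'\in\ker(A[f]),\ \ \langle b[\gamma],x'\rangle-t'=0\ \ \forall (1,\gamma)\in\mathcal F\right\},\qquad (1,f)\in\operatorname{rint}(\mathcal F),$$ is nontrivial (i.e., not equal to $\{0\}$).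
   Context: Let $n,m$ be positive integers. Let $\mathbb S^n$ be the real symmetric $n\times n$ matrices with trace inner product. For $i\in\{0,1,\dots,m\}$ let $q_i:\mathbb R^n\to\mathbb R$, $q_i(x)=x^\top A_i x+2b_i^\top x+c_i$ with $A_i\in\mathbb S^n$, $b_i\in\mathbb R^n$, $c_i\in\mathbb R$ (possibly nonconvex); $q_0$ is the objective and $q_1,\dots,q_m$ are the constraints. Let $q(x)=(q_0(x),\dots,q_m(x))\in\mathbb R^{1+m}$ and let $e_0\in\mathbb R^{1+m}$ be the unit vector of the coordinate indexed $0$. For $(\gamma_0,\gamma)\in\mathbb R^{1+m}$ let $A(\gamma_0,\gamma)=\sum_{i=0}^m\gamma_iA_i$. For $\gamma\in\mathbb R^m$ let $A[\gamma]=A_0+\sum_{i=1}^m\gamma_iA_i$, $b[\gamma]=b_0+\sum_{i=1}^m\gamma_ib_i$, and $[\gamma,q(x)]=q_0(x)+\sum_{i=1}^m\gamma_iq_i(x)$. Define $$\Gamma=\{(\gamma_0,\gamma)\in\mathbb R_+\times\mathbb R_+^m: A(\gamma_0,\gamma)\succeq 0\},\qquad \Gamma_1=\{\gamma\in\mathbb R_+^m: A[\gamma]\succeq 0\}.$$ Epigraph of the QCQP: $\mathcal S=\{(x,t)\in\mathbb R^n\times\mathbb R: q_0(x)\le 2t,\ q_i(x)\le 0\ \forall i\in\{1,\dots,m\}\}$. Projected SDP relaxation: $\mathcal S_{\mathrm{SDP}}$ is the set of $(x,t)\in\mathbb R^n\times\mathbb R$ for which there is $X\in\mathbb S^n$ with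 $X\succeq xx^\top$, $\langle A_0,X\rangle+2b_0^\top x+c_0\le 2t$, and $\langle A_i,X\rangle+2b_i^\top x+c_i\le 0$ for all $i\in\{1,\dots,m\}$. Polar cone: $\Gamma^\circ=\{y\in\mathbb R^{1+m}:\langle y,g\rangle\le 0\ \forall g\in\Gamma\}$. Under the first assumption in the claim, $(x,t)\in\mathcal S_{\mathrm{SDP}}$ if and only if $q(x)-2te_0\in\Gamma^\circ$. Faces of cones are nonempty by convention. For $(x,t)\in\mathcal S_{\mathrm{SDP}}$, let $\mathcal G(x,t)$ be the minimal face of $\Gamma^\circ$ containing $q(x)-2te_0$, let $\mathcal F(x,t)=\Gamma\cap\mathcal G(x,t)^\perp=\Gamma\cap(q(x)-2te_0)^\perp$ (a face of $\Gamma$), and define $$\mathcal R'(x,t)=\{(x',t')\in\mathbb R^{n+1}: q(x+\alpha x')-2(t+\alpha t')e_0\in\operatorname{span}(\mathcal G(x,t))\ \ \forall\alpha\in\mathbb R\}.$$ $\operatorname{rint}$ denotes relative interior. In part (2), such an $f$ exists for each face considered, and the displayed set does not depend on the choice of $f$ with $(1,f)\in\operatorname{rint}(\mathcal F)$. *)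

(* Defs.v *)
From mathcomp Require Import all_boot all_order all_algebra.
From mathcomp Require Import all_classical all_reals all_analysis.

Set Implicit Arguments.
Unset Strict Implicit.
Unset Printing Implicit Defensive.

Import Order.TTheory GRing.Theory Num.Theory.
Import numFieldNormedType.Exports.

Local Open Scope classical_set_scope.
Local Open Scope ring_scope.

Definition dot (R : realType) (d : nat) (u v : 'cV[R]_d) : R :=
  (u^T *m v) 0 0.

Definition trdot (R : realType) (n : nat) (A X : 'M[R]_n) : R :=
  \tr (A^T *m X).

Definition psd (R : realType) (n : nat) (A : 'M[R]_n) : Prop :=
  A^T = A /\ forall x : 'cV[R]_n, 0 <= dot x (A *m x).

Definition pd (R : realType) (n : nat) (A : 'M[R]_n) : Prop :=
  A^T = A /\ forall x : 'cV[R]_n, x != 0 -> 0 < dot x (A *m x).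

Definition subspace_set (R : realType) (V : lmodType R) (W : set V) : Prop :=
  W 0 /\ forall (a : R) (u v : V), W u -> W v -> W (a *: u + v).

Definition lin_span (R : realType) (V : lmodType R) (S : set V) : set V :=
  smallest (@subspace_set R V) S.

Definition affine_set (R : realType) (V : lmodType R) (W : set V) : Prop :=
  forall (a : R) (u v : V), W u -> W v -> W (a *: u + (1 - a) *: v).

Definition aff_hull (R : realType) (V : lmodType R) (S : set V) : set V :=
  smallest (@affine_set R V) S.

Definition conv_hull (R : realType) (V : lmodType R) (S : set V) : set V :=
  smallest (@convex_set R V) S.

Definition rint (R : realType) (V : normedModType R) (S : set V) : set V :=
  [set x | S x /\ \forall y \near x, aff_hull S y -> S y].

Definition polyhedral (R : realType) (d : nat) (S : set 'cV[R]_d) : Prop :=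
  exists (k : nat) (M : 'M[R]_(k, d)) (v : 'cV[R]_k),
    S = [set g : 'cV[R]_d | forall i, (M *m g) i 0 <= v i 0].

Definition polar (R : realType) (d : nat) (K : set 'cV[R]_d) : set 'cV[R]_d :=
  [set y : 'cV[R]_d | forall g, K g -> dot y g <= 0].

Definition perp (R : realType) (d : nat) (S : set 'cV[R]_d) : set 'cV[R]_d :=
  [set g : 'cV[R]_d | forall y, S y -> dot y g = 0].

Definition is_face (R : realType) (V : lmodType R) (K F : set V) : Prop :=
  [/\ F !=set0, F `<=` K, @convex_set R V F &
      forall (u v : V) (l : R), K u -> K v -> 0 < l < 1 ->
        F (l *: u + (1 - l) *: v) -> F u /\ F v].

(* An intersection of faces containing y is again a face containing y, so for
   y in K this is the least such face. *)
Definition min_face (R : realType) (V : lmodType R) (K : set V) (y : V) :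
    set V :=
  smallest (is_face K) [set y].

(* Index ord0 is the objective, indices lift ord0 i the m constraints. *)
Record qcqp (R : realType) (n m : nat) := QCQP {
  qA : 'I_m.+1 -> 'M[R]_n ;
  qb : 'I_m.+1 -> 'cV[R]_n ;
  qc : 'I_m.+1 -> R ;
  qA_sym : forall i, (qA i)^T = qA i }.

(* R^o rather than R so that pairs (x, t) form an lmodType. *)
Notation xtspace R n := ('cV[R]_n * R^o)%type.

Definition hvec (R : realType) (m : nat) (g0 : R) (g : 'cV[R]_m) :
    'cV[R]_m.+1 :=
  col_mx g0%:M g : 'cV[R]_(1 + m).

Section QCQP.
Context (R : realType) (n m : nat) (P : qcqp R n m).
Implicit Types (x : 'cV[R]_n) (p : xtspace R n) (g : 'cV[R]_m).

Definition qval (i : 'I_m.+1) x : R :=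
  dot x (qA P i *m x) + 2 * dot (qb P i) x + qc P i.

Definition qvec x : 'cV[R]_m.+1 := \col_i qval i x.

Definition e0 : 'cV[R]_m.+1 := delta_mx ord0 0.

Definition Ahom (h : 'cV[R]_m.+1) : 'M[R]_n := \sum_i h i 0 *: qA P i.

Definition Aagg g : 'M[R]_n :=
  qA P ord0 + \sum_(i < m) g i 0 *: qA P (lift ord0 i).

Definition bagg g : 'cV[R]_n :=
  qb P ord0 + \sum_(i < m) g i 0 *: qb P (lift ord0 i).

Definition qagg g x : R :=
  qval ord0 x + \sum_(i < m) g i 0 * qval (lift ord0 i) x.

Definition Gam : set 'cV[R]_m.+1 :=
  [set h : 'cV[R]_m.+1 | (forall i, 0 <= h i 0) /\ psd (Ahom h)].

Definition Gam1 : set 'cV[R]_m :=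
  [set g : 'cV[R]_m | (forall i, 0 <= g i 0) /\ psd (Aagg g)].

Definition epi : set (xtspace R n) :=
  [set p : xtspace R n | qval ord0 p.1 <= 2 * p.2 /\
           forall i : 'I_m, qval (lift ord0 i) p.1 <= 0].

Definition sdp : set (xtspace R n) :=
  [set p : xtspace R n | exists X : 'M[R]_n,
    [/\ X^T = X,
        psd (X - p.1 *m p.1^T),
        trdot (qA P ord0) X + 2 * dot (qb P ord0) p.1 + qc P ord0 <= 2 * p.2 &
        forall i : 'I_m,
          trdot (qA P (lift ord0 i)) X + 2 * dot (qb P (lift ord0 i)) p.1
            + qc P (lift ord0 i) <= 0]].

Definition resid x (t : R) : 'cV[R]_m.+1 := qvec x - (2 * t) *: e0.

Definition tight p : Prop :=
  ereal_sup [set (qagg g p.1)%:E | g in Gam1] = (2 * p.2)%:E.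

Definition Gface p : set 'cV[R]_m.+1 := min_face (polar Gam) (resid p.1 p.2).

Definition Fface p : set 'cV[R]_m.+1 := Gam `&` perp (Gface p).

Definition Rprime p : set (xtspace R n) :=
  [set d : xtspace R n | forall a : R,
    lin_span (Gface p) (resid (p.1 + a *: d.1) (p.2 + a * d.2))].

Definition dirs (F : set 'cV[R]_m.+1) (f : 'cV[R]_m) : set (xtspace R n) :=
  [set d : xtspace R n | Aagg f *m d.1 = 0 /\
           forall g, F (hvec 1 g) -> dot (bagg g) d.1 - d.2 = 0].

(* The faces over which the convex hull criterion quantifies. *)
Definition tested_face (F : set 'cV[R]_m.+1) : Prop :=
  is_face Gam F /\
  exists p, [/\ sdp p, ~ epi p, tight p & F = Gam `&` perp [set resid p.1 p.2]].

End QCQP.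

(* Main.v *)
Require Import Defs.
From mathcomp Require Import all_boot all_order all_algebra.
From mathcomp Require Import all_classical all_reals all_analysis.
From mathcomp Require Import ring lra.
Set Implicit Arguments.
Unset Strict Implicit.
Unset Printing Implicit Defensive.

Import Order.TTheory GRing.Theory Num.Theory.
Import numFieldNormedType.Exports.
Local Open Scope classical_set_scope.
Local Open Scope ring_scope.

(** Write S for the epigraph, K for the cone Gam and K° for its polar, and attach
    to p = (x, t) the residual y(p) = q(x) - 2 t e_0.  Conic duality
    ([sdp_duality]) identifies the projected SDP relaxation with the set of p such
    that y(p) lies in K°, and the face attached to p is F(p) = K ∩ y(p)^⊥
    ([perp_min_face]).

    Along a line p + a d the number <g, y(p + a d)> is, for every g in K, a convex
    quadratic polynomial in a.  It is constant exactly when A(g) d_x = 0 and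
    <b(g), d_x> = g_0 d_t; call d flat for g.  For f such that (1, f) lies in the
    relative interior of a face F, the kernel of the positive semidefinite A[f] is
    contained in that of every A(g) with g in F, and the g in F with g_0 = 1
    determine the linear conditions for the others by scaling and translation.  So
    the set [dirs] is the set of directions flat for all of F ([dirsP]); in
    particular it does not depend on f.

    Polyhedrality enters through Farkas' lemma, in three ways.  If z is orthogonal
    to F(p) then y(p) ± e z stays in K° for small e ([polar_move]); hence the
    minimal face of y(p) spans F(p)^⊥ ([span_min_face]), and [Rprime] is again the
    set of directions flat on F(p).  The supremum defining tightness is attained,
    so F(p) contains a multiplier with first coordinate 1 ([tight_attained]).
    Finally a face is determined by the defining inequalities of K that are tight
    on it ([card_tight_on]), which bounds the length of chains of faces.

    Necessity of the criterion: a point of conv(S) outside S is not extreme, so it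
    is interior to a segment contained in the relaxation.  On that segment the
    convex quadratics above are nonpositive and vanish at p when g is in F(p);
    they are therefore identically zero, and the direction of the segment is a
    nonzero flat direction.

    Sufficiency: lowering t to the dual bound reduces the claim to tight points.
    From a tight point outside S, follow a nonzero flat direction both ways until
    feasibility is about to be lost; positive definiteness of some A(h) makes both
    moves finite.  Both endpoints are tight and have strictly larger faces
    ([boundary_step]), so by induction they lie in conv(S), and so does p. *)

(** * Inner products and positive semidefinite matrices *)

Section Dot.
Context {R : realType} {d : nat}.
Implicit Types (u v w : 'cV[R]_d) (a : R).

Lemma dotE u v : dot u v = \sum_i u i 0 * v i 0.
Proof. by rewrite /dot mxE; apply: eq_bigr => i _; rewrite mxE. Qed.

Lemma dotC u v : dot u v = dot v u.
Proof. by rewrite !dotE; apply: eq_bigr => i _; rewrite mulrC. Qed.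

Lemma dotDl u v w : dot (u + v) w = dot u w + dot v w.
Proof. by rewrite /dot linearD mulmxDl mxE. Qed.

Lemma dotDr u v w : dot w (u + v) = dot w u + dot w v.
Proof. by rewrite /dot mulmxDr mxE. Qed.

Lemma dotZl a u w : dot (a *: u) w = a * dot u w.
Proof. by rewrite /dot linearZ -scalemxAl mxE. Qed.

Lemma dotZr a u w : dot w (a *: u) = a * dot w u.
Proof. by rewrite /dot -scalemxAr mxE. Qed.

Lemma dot0l w : dot 0 w = 0.
Proof. by rewrite -(scale0r 0) dotZl mul0r. Qed.

Lemma dot0r w : dot w 0 = 0.
Proof. by rewrite dotC dot0l. Qed.

Lemma dotNl u w : dot (- u) w = - dot u w.
Proof. by rewrite -scaleN1r dotZl mulN1r. Qed.

Lemma dotNr u w : dot w (- u) = - dot w u.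
Proof. by rewrite dotC dotNl dotC. Qed.

Lemma dotBl u v w : dot (u - v) w = dot u w - dot v w.
Proof. by rewrite dotDl dotNl. Qed.

Lemma dotBr u v w : dot w (u - v) = dot w u - dot w v.
Proof. by rewrite dotDr dotNr. Qed.

Lemma dot_suml (I : Type) (r : seq I) (Q : pred I) (F : I -> 'cV[R]_d) w :
  dot (\sum_(i <- r | Q i) F i) w = \sum_(i <- r | Q i) dot (F i) w.
Proof.
by elim/big_rec2: _ => [|i x y _ <-]; rewrite ?dot0l// dotDl.
Qed.

Lemma dot_sumr (I : Type) (r : seq I) (Q : pred I) (F : I -> 'cV[R]_d) w :
  dot w (\sum_(i <- r | Q i) F i) = \sum_(i <- r | Q i) dot w (F i).
Proof. by rewrite dotC dot_suml; apply: eq_bigr => i _; rewrite dotC. Qed.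

Lemma dot_delta (i : 'I_d) w : dot (delta_mx i 0) w = w i 0.
Proof.
rewrite dotE (bigD1 i)//= mxE !eqxx mul1r big1 ?addr0// => j ji.
by rewrite mxE (negPf ji) mul0r.
Qed.

Lemma dot_ge0 u : 0 <= dot u u.
Proof. by rewrite dotE sumr_ge0// => i _; rewrite -expr2 sqr_ge0. Qed.

Lemma dot_eq0 u : dot u u = 0 -> u = 0.
Proof.
move=> h; apply/matrixP => i j; rewrite (ord1 j) mxE.
have : u i 0 * u i 0 = 0.
  move/eqP: h; rewrite dotE psumr_eq0; last by move=> k _; rewrite -expr2 sqr_ge0.
  by move/allP/(_ i (mem_index_enum _)) => /eqP.
by move/eqP; rewrite mulf_eq0 orbb => /eqP.
Qed.

End Dot.

Section Psd.
Context {R : realType} {n : nat}.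
Implicit Types (A B : 'M[R]_n) (u v w x y : 'cV[R]_n).

Lemma dot_mulmx A x y : dot x (A *m y) = dot (A^T *m x) y.
Proof. by rewrite /dot trmx_mul trmxK mulmxA. Qed.

Lemma dot_sym A x y : A^T = A -> dot x (A *m y) = dot y (A *m x).
Proof. by move=> As; rewrite dot_mulmx As dotC. Qed.

(** Cauchy-Schwarz inequality for a positive semidefinite form. *)
Lemma psd_cs A x y : psd A ->
  dot x (A *m y) ^+ 2 <= dot x (A *m x) * dot y (A *m y).
Proof.
move=> [As Ap].
have Q a b : 0 <= a ^+ 2 * dot x (A *m x) + 2 * a * b * dot x (A *m y)
    + b ^+ 2 * dot y (A *m y).
  have := Ap (a *: x + b *: y).
  rewrite mulmxDr -!scalemxAr !dotDl !dotDr !dotZl !dotZr (dot_sym _ _ As).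
  by move=> h; apply: le_trans h _; rewrite le_eqVlt; apply/orP; left;
    apply/eqP; ring.
set p := dot x (A *m x); set r := dot y (A *m y); set b := dot x (A *m y).
have r0 : 0 <= r by exact: Ap.
have [re|rn] := eqVneq r 0.
  rewrite re mulr0; have [->|bn] := eqVneq b 0; first by rewrite expr0n.
  have := Q 1 (- (p + 1) / (2 * b)); rewrite -/p -/r -/b re mulr0 addr0.
  have -> : 1 ^+ 2 * p + 2 * 1 * (- (p + 1) / (2 * b)) * b = -1 by field.
  by rewrite ler0N1.
have rp : 0 < r by rewrite lt_def rn.
have := Q r (- b); rewrite -/p -/r -/b.
have -> : r ^+ 2 * p + 2 * r * - b * b + (- b) ^+ 2 * r = r * (p * r - b ^+ 2).
  by ring.
by rewrite pmulr_rge0// subr_ge0.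
Qed.

Lemma psd_ker A x : psd A -> dot x (A *m x) = 0 -> A *m x = 0.
Proof.
move=> Ap h; apply: dot_eq0.
have := psd_cs (A *m x) x Ap; rewrite h mulr0 => h2.
by apply/eqP; rewrite -sqrf_eq0 eq_le h2 sqr_ge0.
Qed.

Lemma dot_outer v x y : dot x ((v *m v^T) *m y) = dot v x * dot v y.
Proof.
rewrite -mulmxA [v^T *m y]mx11_scalar -/(dot v y) mul_mx_scalar dotZr.
by rewrite (dotC x) mulrC.
Qed.

Lemma psd_outer v : psd (v *m v^T).
Proof.
split; first by rewrite trmx_mul trmxK.
by move=> x; rewrite dot_outer -expr2 sqr_ge0.
Qed.

Lemma psdD A B : psd A -> psd B -> psd (A + B).
Proof.
move=> [As Ap] [Bs Bp]; split; first by rewrite linearD /= As Bs.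
by move=> x; rewrite mulmxDl dotDr addr_ge0.
Qed.

Lemma psdZ A (a : R) : 0 <= a -> psd A -> psd (a *: A).
Proof.
move=> a0 [As Ap]; split; first by rewrite linearZ /= As.
by move=> x; rewrite -scalemxAl dotZr mulr_ge0.
Qed.

Lemma psd0 : psd (0 : 'M[R]_n).
Proof. by split; [rewrite trmx0|move=> x; rewrite mul0mx dot0r]. Qed.

Lemma pd_psd A : pd A -> psd A.
Proof.
move=> [As Ap]; split=> // x; have [->|x0] := eqVneq x 0.
  by rewrite mulmx0 dot0r.
exact/ltW/Ap.
Qed.

(** Every positive semidefinite matrix is a sum of rank-one matrices: eliminate
    one pivot at a time by a Schur complement, which keeps the rows already
    cleared at zero. *)
Lemma psd_decomp A : psd A ->
  exists s : seq 'cV[R]_n, A = \sum_(v <- s) v *m v^T.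
Proof.
have [k] := ubnP #|[pred i | row i A != 0]|; elim: k A => // k IH A cardA Ap.
have [As Apos] := Ap.
have diag i : dot (delta_mx i 0) (A *m delta_mx i 0) = A i i.
  by rewrite dot_delta -colE mxE.
have colrow i : A *m delta_mx i 0 = (row i A)^T.
  by rewrite -colE tr_row As.
have [[i Ai]|none] := pselect (exists i, row i A != 0); last first.
  exists [::]; rewrite big_nil; apply/row_matrixP => i; rewrite row0.
  by apply/eqP/negPn/negP => Ai; apply: none; exists i.
have Aii : 0 < A i i.
  rewrite lt_def -{2}diag Apos andbT; apply: contra_neq Ai => Aii.
  by apply: trmx_inj; rewrite trmx0 -colrow (psd_ker Ap)// diag.
pose c : 'cV[R]_n := A *m delta_mx i 0.
pose B := A - (A i i)^-1 *: (c *m c^T).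
have Bp : psd B.
  split.
    by rewrite /B linearB linearZ /= (psd_outer c).1 As.
  move=> x; rewrite /B mulmxBl -scalemxAl dotBr dotZr dot_outer subr_ge0.
  rewrite mulrC ler_pdivrMr// -expr2 /c dotC.
  by rewrite -[X in _ <= _ * X]diag psd_cs.
have rowB j : row j B = row j A - ((A i i)^-1 * c j 0) *: c^T.
  by apply/rowP => l; rewrite !mxE big_ord1 !mxE mulrA.
have ci : c i 0 = A i i by rewrite /c -colE mxE.
have Bi : row i B = 0.
  by rewrite rowB ci mulVf ?gt_eqF// scale1r /c colrow trmxK subrr.
have Bj j : row j A = 0 -> row j B = 0.
  move=> Aj; rewrite rowB Aj.
  have -> : c j 0 = 0.
    by rewrite /c -colE mxE; move/rowP/(_ i): Aj; rewrite !mxE.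
  by rewrite mulr0 scale0r subr0.
have [s Bs] : exists s : seq 'cV[R]_n, B = \sum_(v <- s) v *m v^T.
  apply: IH => //; rewrite -ltnS; apply: leq_trans cardA; rewrite ltnS.
  apply: proper_card; apply/properP; split.
    by apply/fintype.subsetP => j; rewrite !inE; apply: contra_neq => /Bj.
  by exists i; rewrite ?inE ?Bi ?eqxx.
exists (Num.sqrt (A i i)^-1 *: c :: s); rewrite big_cons -Bs /B.
rewrite linearZ /= -scalemxAr -scalemxAl scalerA -expr2 sqr_sqrtr ?invr_ge0 ?ltW//.
by rewrite addrC subrK.
Qed.

Lemma trdot_outer A v : trdot A (v *m v^T) = dot v (A *m v).
Proof.
rewrite /trdot mulmxA mxtrace_mulC /mxtrace big_ord1 -/(dot v _).
by rewrite dot_mulmx trmxK dotC.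
Qed.

Lemma trdotDr A B C : trdot A (B + C) = trdot A B + trdot A C.
Proof. by rewrite /trdot mulmxDr raddfD. Qed.

Lemma trdotBr A B C : trdot A (B - C) = trdot A B - trdot A C.
Proof. by rewrite /trdot mulmxBr raddfB. Qed.

Lemma trdotZr A B (a : R) : trdot A (a *: B) = a * trdot A B.
Proof. by rewrite /trdot -scalemxAr mxtraceZ. Qed.

Lemma trdotDl A B C : trdot (A + B) C = trdot A C + trdot B C.
Proof. by rewrite /trdot raddfD /= mulmxDl raddfD. Qed.

Lemma trdotZl A B (a : R) : trdot (a *: A) B = a * trdot A B.
Proof. by rewrite /trdot linearZ -scalemxAl mxtraceZ. Qed.

Lemma trdot_suml (I : Type) (r : seq I) (Q : pred I) (F : I -> 'M[R]_n) B :
  trdot (\sum_(i <- r | Q i) F i) B = \sum_(i <- r | Q i) trdot (F i) B.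
Proof.
elim/big_rec2: _ => [|i x y _ <-]; last by rewrite trdotDl.
by rewrite -(scale0r 0) trdotZl mul0r.
Qed.

Lemma trdot_sumr (I : Type) (r : seq I) (Q : pred I) (F : I -> 'M[R]_n) B :
  trdot B (\sum_(i <- r | Q i) F i) = \sum_(i <- r | Q i) trdot B (F i).
Proof.
elim/big_rec2: _ => [|i x y _ <-]; last by rewrite trdotDr.
by rewrite -(scale0r 0) trdotZr mul0r.
Qed.

Lemma trdot_psd_ge0 A B : psd A -> psd B -> 0 <= trdot A B.
Proof.
move=> [As Ap] /psd_decomp[s ->]; rewrite trdot_sumr sumr_ge0// => v _.
by rewrite trdot_outer.
Qed.

End Psd.

(** * Farkas' lemma and convex hulls *)

Section Farkas.
Context {R : realType} {d : nat}.
Implicit Types (y z g : 'cV[R]_d).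

(** By induction on the number of inequalities: if the implication fails at g0
    once the first inequality is dropped, project along g0 onto its kernel. *)
Lemma farkas k (a : 'I_k -> 'cV[R]_d) z :
  (forall g, (forall i, dot (a i) g <= 0) -> dot z g <= 0) ->
  exists l : 'I_k -> R, (forall i, 0 <= l i) /\ z = \sum_i l i *: a i.
Proof.
elim: k a z => [|k IH] a z H.
  exists (fun=> 0); split=> //; rewrite big_ord0; apply: dot_eq0.
  by apply/le_anti; rewrite dot_ge0 andbT; apply: H => -[].
pose b i := a (lift ord0 i).
have [Hb|/existsNP[g0 /not_implyP[bg0 /negP zg0]]] := pselect (forall g,
    (forall i, dot (b i) g <= 0) -> dot z g <= 0).
  have [l [l0 ->]] := IH b z Hb.
  exists (fun i => oapp l 0 (unlift ord0 i)); split.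
    by move=> i; case: unliftP => [j _|_] /=.
  rewrite big_ord_recl unlift_none /= scale0r add0r.
  by apply: eq_bigr => i _; rewrite liftK.
rewrite -ltNge in zg0.
set a0 := a ord0.
have ag0 : 0 < dot a0 g0.
  rewrite ltNge; apply/negP => ag0; move: zg0; rewrite ltNge H// => i.
  by case: (unliftP ord0 i) => [j ->|->] //; exact: bg0.
(* pg is the projection along g0 onto the kernel of a0, and pr its adjoint *)
pose pr (v : 'cV[R]_d) : 'cV[R]_d := v - (dot v g0 / dot a0 g0) *: a0.
pose pg g : 'cV[R]_d := g - (dot a0 g / dot a0 g0) *: g0.
have prE v g : dot (pr v) g = dot v (pg g).
  by rewrite /pr /pg dotBl dotBr dotZl dotZr; congr (_ - _);
    rewrite mulrC mulrA mulrAC.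
have [|l [l0 lE]] := IH (pr \o b) (pr z).
  move=> g Hg; rewrite prE; apply: H => i.
  case: (unliftP ord0 i) => [j ->|->].
    by rewrite -prE; exact: Hg.
  by rewrite /pg dotBr dotZr divfK ?subrr// gt_eqF.
have zE : z = \sum_i l i *: b i
    + ((dot z g0 - \sum_i l i * dot (b i) g0) / dot a0 g0) *: a0.
  have /eqP := lE; rewrite subr_eq => /eqP {1}->.
  under eq_bigr do rewrite /= scalerBr scalerA mulrA.
  rewrite sumrB -scaler_suml -mulr_suml -addrA -scaleNr -scalerDl.
  by rewrite mulrBl [- _ + _]addrC.
exists (fun i => oapp l ((dot z g0 - \sum_i l i * dot (b i) g0) / dot a0 g0)
  (unlift ord0 i)); split.
  move=> i; case: (unliftP ord0 i) => [j _|_] //=.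
  apply: divr_ge0; last exact: ltW.
  rewrite subr_ge0 (le_trans _ (ltW zg0))//.
  by rewrite sumr_le0// => j _; rewrite mulr_ge0_le0.
rewrite big_ord_recl unlift_none /= {1}zE addrC; congr (_ + _).
by apply: eq_bigr => i _; rewrite liftK.
Qed.

End Farkas.

Section Convex.
Context {R : realType} {V : lmodType R}.
Implicit Types (S : set V) (u v : V).

Lemma convex_setP S : @convex_set R V S <->
  (forall u v (l : R), 0 < l < 1 -> S u -> S v -> S (l *: u + (1 - l) *: v)).
Proof.
split=> [cS u v l /andP[l0 l1] Su Sv|cS].
  have := cS u v (Itv01 (ltW l0) (ltW l1)) (mem_set Su) (mem_set Sv).
  by move/set_mem.
apply/convex_setW => u v /set_mem Su /set_mem Sv l l0 l1.
by apply/mem_set; apply: (cS u v l%:num) => //; apply/andP.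
Qed.

Lemma conv_hull_sub S (T : set V) :
  S `<=` T -> @convex_set R V T -> conv_hull S `<=` T.
Proof. by move=> ST cT v /(_ T); apply. Qed.

Lemma sub_conv_hull S : S `<=` conv_hull S.
Proof. by move=> v Sv T [_]; apply. Qed.

Lemma convex_conv_hull S : @convex_set R V (conv_hull S).
Proof.
apply/convex_setP => u v l l01 Su Sv T [cT ST].
by move/convex_setP: (cT); apply=> //; [apply: Su|apply: Sv]; split.
Qed.

(** A point of the convex hull lying outside S is not extreme: removing an
    extreme point outside S from the hull would leave a smaller convex set
    containing S. *)
Lemma conv_hull_not_extreme S v :
  conv_hull S v -> ~ S v -> exists u w (l : R),
  [/\ conv_hull S u, conv_hull S w, 0 < l < 1, u <> w & v = l *: u + (1 - l) *: w].
Proof.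
move=> Cv nSv; apply: contrapT => none.
have : ([set w | conv_hull S w /\ w <> v]) v; last by case.
apply: (conv_hull_sub (S := S)) Cv.
  by move=> u Su; split; [exact: sub_conv_hull|move=> uv; apply: nSv; rewrite -uv].
apply/convex_setP => u w l l01 [Cu uv] [Cw wv].
split; first exact: (convex_setP _).1 (convex_conv_hull (S := S)) _ _ l l01 Cu Cw.
move=> E; apply: none; exists u, w, l; split=> //.
by move=> uw; apply: uv; rewrite -E uw -scalerDl addrC subrK scale1r.
Qed.

End Convex.

(** * Polyhedral cones, their polars and exposed faces *)

Lemma addr_le0 (R : numDomainType) (x y : R) : x <= 0 -> y <= 0 -> x + y <= 0.
Proof. by move=> x0 y0; rewrite -(addr0 0) lerD. Qed.

Lemma sum_continuous (R : realType) (T : topologicalType) (I : Type)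
    (r : seq I) (F : I -> T -> R) :
  (forall i, continuous (F i)) -> continuous (fun x => \sum_(i <- r) F i x).
Proof. by move=> cF; apply: continuous_big => //; exact: add_continuous. Qed.

Lemma mulc_continuous (R : realType) (T : topologicalType) (c : R) (f : T -> R) :
  continuous f -> continuous (fun x => c * f x).
Proof. by move=> cf x; apply: cvgM; [exact: cvg_cst|exact: cf]. Qed.

Section Cones.
Context {R : realType} {d : nat}.
Implicit Types (K F : set 'cV[R]_d) (y z g h : 'cV[R]_d).

(** Convex cones, as sets containing 0 and closed under nonnegative
    combinations. *)
Definition cone K :=
  K 0 /\ forall (a b : R) g h, 0 <= a -> 0 <= b -> K g -> K h ->
    K (a *: g + b *: h).

Lemma coneD K g h : cone K -> K g -> K h -> K (g + h).
Proof.
by move=> [_ cK] Kg Kh; rewrite -(scale1r g) -(scale1r h); apply: cK.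
Qed.

Lemma coneZ K (a : R) g : cone K -> 0 <= a -> K g -> K (a *: g).
Proof.
by move=> [K0 cK] a0 Kg; rewrite -[_ *: _]addr0 -(scale0r 0); apply: cK.
Qed.

Lemma cone_sum K (I : Type) (r : seq I) (G : I -> 'cV[R]_d) :
  cone K -> (forall i, K (G i)) -> K (\sum_(i <- r) G i).
Proof.
move=> cK KG; elim/big_ind: _ => //; [exact: cK.1|exact: (fun x y => @coneD _ x y cK)].
Qed.

Lemma cone_convex K : cone K -> @convex_set R _ K.
Proof.
move=> cK; apply/convex_setP => u v l /andP[l0 l1] Ku Kv.
by apply: cK.2 => //; [exact: ltW|rewrite subr_ge0 ltW].
Qed.

Lemma cone_polar K : cone (polar K).
Proof.
split=> [g _|a b y z a0 b0 Ky Kz g Kg]; first by rewrite dot0l.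
by rewrite dotDl !dotZl addr_le0// mulr_ge0_le0//; [apply: Ky|apply: Kz].
Qed.

Lemma cone_perp K y : cone K -> cone (K `&` perp [set y]).
Proof.
move=> cK; split=> [|a b g h a0 b0 [Kg yg] [Kh yh]].
  by split; [exact: cK.1|move=> _ ->; rewrite dot0r].
split; first exact: cK.2.
by move=> _ ->; rewrite dotDr !dotZr yg// yh// !mulr0 addr0.
Qed.

Lemma perp1 y g : perp [set y] g <-> dot y g = 0.
Proof. by split=> [|h _ ->//]; apply. Qed.

Lemma face_perp K y : cone K -> (forall g, K g -> dot y g <= 0) ->
  is_face K (K `&` perp [set y]).
Proof.
move=> cK Ky; split.
- by exists 0; exact: (cone_perp y cK).1.
- by move=> g [].
- exact/cone_convex/cone_perp.
- move=> u v l Ku Kv /andP[l0 l1] [_ /perp1].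
  rewrite dotDr !dotZr => h.
  have [yu yv] := (Ky u Ku, Ky v Kv).
  have l1' : 0 < 1 - l by rewrite subr_gt0.
  have := mulr_ge0_le0 (ltW l0) yu; have := mulr_ge0_le0 (ltW l1') yv.
  move=> h1 h2.
  have /eqP : l * dot y u = 0 by lra.
  have /eqP : (1 - l) * dot y v = 0 by lra.
  rewrite !mulf_eq0 (gt_eqF l0) (gt_eqF l1') /= => /eqP yv0 /eqP yu0.
  by split; split=> //; apply/perp1.
Qed.

(** A cone element orthogonal to y exposes a face of the polar cone, so it is
    orthogonal to the whole minimal face of y. *)
Lemma perp_min_face K y : cone K -> polar K y ->
  K `&` perp (min_face (polar K) y) = K `&` perp [set y].
Proof.
move=> cK Ky; apply/seteqP; split=> g [Kg] yg; split=> //.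
  by move=> _ ->; apply: yg => F [_]; exact.
move=> z /(_ (polar K `&` perp [set g])); case.
  split; last by move=> _ ->; split=> //; apply/perp1; rewrite dotC; apply/perp1.
  apply: face_perp; first exact: cone_polar.
  by move=> w /(_ g Kg); rewrite dotC.
by move=> _ /perp1; rewrite dotC.
Qed.

(** From a relative interior point one can move slightly away from any other
    point of the set. *)
Lemma rint_sub (F : set 'cV[R]_d) g h : rint F g -> F h ->
  exists2 e : R, 0 < e & F (g + e *: (g - h)).
Proof.
move=> [Fg /nbhs_ballP[r /= r0 Hr]] Fh.
pose e := r / 2 / (`|g - h| + 1).
have h1 : 0 < `|g - h| + 1 by rewrite ltr_wpDl.
have e0 : 0 < e by rewrite !divr_gt0.
exists e => //; apply: Hr.
  rewrite -ball_normE /ball_ /= opprD addNKr normrN normrZ gtr0_norm//.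
  rewrite /e mulrAC ltr_pdivrMr// -mulrA ltr_pM2l//.
  by have := normr_ge0 (g - h); lra.
move=> W [aW FW].
have := aW (1 + e) g h (FW _ Fg) (FW _ Fh).
have -> // : (1 + e) *: g + (1 - (1 + e)) *: h = g + e *: (g - h).
by rewrite scalerDl scale1r scalerBr opprD addrA subrr sub0r scaleNr addrA.
Qed.

Lemma dot_continuous y : continuous (dot y).
Proof.
have -> : dot y = fun g => \sum_i y i 0 * g i 0 by apply/funext => g; rewrite dotE.
apply: sum_continuous => i; apply: mulc_continuous.
exact: coord_continuous.
Qed.

End Cones.

Section PolyCone.
Context {R : realType} {d k : nat} (a : 'I_k -> 'cV[R]_d).
Implicit Types (y z g h : 'cV[R]_d).

(** The polyhedral cone cut out by finitely many homogeneous inequalities. *)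
Definition hcone : set 'cV[R]_d := [set g | forall i, dot (a i) g <= 0].

Lemma cone_hcone : cone hcone.
Proof.
split=> [i|b c g h b0 c0 Kg Kh i]; first by rewrite dot0r.
by rewrite dotDr !dotZr addr_le0// mulr_ge0_le0.
Qed.

Lemma polar_hcone y : polar hcone y ->
  exists l : 'I_k -> R, (forall i, 0 <= l i) /\ y = \sum_i l i *: a i.
Proof. by move=> Ky; apply: farkas => g Kg; apply: Ky. Qed.

(** Farkas' lemma with one extra homogeneous inequality. *)
Lemma farkas_polar y z :
  (forall g, hcone g -> 0 <= dot y g -> dot z g <= 0) ->
  exists2 nu : R, 0 <= nu & polar hcone (z + nu *: y).
Proof.
move=> H.
have [|l [l0 ->]] := @farkas _ _ k.+1 (fun i => oapp a (- y) (unlift ord0 i)) z.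
  move=> g Hg; apply: H => [i|].
    by have := Hg (lift ord0 i); rewrite liftK.
  by have := Hg ord0; rewrite unlift_none /= dotNl oppr_le0.
exists (l ord0) => // g Kg.
rewrite big_ord_recl unlift_none /= scalerN addrAC addNr add0r dot_suml.
rewrite sumr_le0// => i _; rewrite liftK /= dotZl mulr_ge0_le0//; exact: Kg.
Qed.

(** Polyhedrality makes the polar cone locally conical: directions orthogonal to
    the face exposed by y can be followed for a while. *)
Lemma polar_move y z : polar hcone y ->
  (forall g, hcone g -> dot y g = 0 -> dot z g = 0) ->
  exists2 e : R, 0 < e & forall t, `|t| <= e -> polar hcone (y + t *: z).
Proof.
move=> Ky H.
have F w : (forall g, hcone g -> dot y g = 0 -> dot w g = 0) ->
    exists2 e : R, 0 < e & forall t, 0 <= t <= e -> polar hcone (y + t *: w).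
  move=> Hw; have [|nu nu0 Kn] := @farkas_polar y w.
    move=> g Kg yg; rewrite Hw//; apply/le_anti; rewrite yg andbT; exact: Ky.
  have n1 : 0 < nu + 1 by rewrite ltr_wpDl.
  exists (nu + 1)^-1; first by rewrite invr_gt0.
  move=> t /andP[t0]; rewrite -[_^-1]div1r ler_pdivlMr// => tn.
  have -> : y + t *: w = t *: (w + nu *: y) + (1 - t * nu) *: y.
    rewrite scalerDr scalerBl scale1r scalerA -addrA addrC; congr (_ + _).
    by rewrite addrC subrK.
  by apply: (cone_polar _).2 => //; nra.
have [e1 e10 H1] := F z H.
have [|e2 e20 H2] := F (- z).
  by move=> g Kg yg; rewrite dotNl H// oppr0.
exists (Num.min e1 e2); first by rewrite lt_min e10.
move=> t; rewrite le_min => /andP[t1 t2]; have [t0|t0] := leP 0 t.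
  by apply: H1; rewrite t0 -(ger0_norm t0).
rewrite -[_ *: _]opprK -scaleNr -scalerN; apply: H2.
by rewrite oppr_ge0 (ltW t0) -(ltr0_norm t0).
Qed.

(** The span of the minimal face of y in the polar cone is the orthogonal
    complement of the face of the cone exposed by y. *)
Lemma span_min_face y z : polar hcone y ->
  lin_span (min_face (polar hcone) y) z <->
  forall g, hcone g -> dot y g = 0 -> dot z g = 0.
Proof.
move=> Ky; have [ck yp] := (cone_hcone, perp_min_face cone_hcone Ky).
split=> [sz g Kg yg|H].
  apply: (sz [set z | dot z g = 0]); split.
    split=> [|b u v /= u0 v0]; first by rewrite /= dot0l.
    by rewrite dotDl dotZl u0 v0 mulr0 addr0.
  have [_ /= pg] : (hcone `&` perp (min_face (polar hcone) y)) g.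
    by rewrite yp; split=> //; apply/perp1.
  by move=> w Fw; exact: pg.
have [e e0 He] := polar_move Ky H.
have Gy : min_face (polar hcone) y y by move=> F [_]; exact.
have Ge : min_face (polar hcone) y (y + e *: z).
  move=> F [[_ FK _ Ff] Fy].
  have := Ff (y + e *: z) (y + (- e) *: z) 2^-1.
  case => //.
  - by apply: He; rewrite gtr0_norm.
  - by apply: He; rewrite normrN gtr0_norm.
  - by apply/andP; split; lra.
  suff -> : 2^-1 *: (y + e *: z) + (1 - 2^-1) *: (y + - e *: z) = y by exact: Fy.
  have -> : 1 - 2^-1 = 2^-1 :> R by lra.
  rewrite -scalerDr addrACA scaleNr subrr addr0 -(mulr2n y) -(scaler_nat 2 y) scalerA.
  by rewrite mulVf ?scale1r// pnatr_eq0.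
move=> W [[W0 Wl] GW].
have -> : z = e^-1 *: ((-1) *: y + (y + e *: z)) + 0.
  by rewrite scaleN1r addKr scalerA mulVf ?scale1r ?addr0// gt_eqF.
by apply: (Wl) => //; apply: (Wl); apply: GW.
Qed.

(** The relative interior of an exposed face contains points of the form
    c (h + s): add up, for each inequality not identically tight on the face,
    one point where it is strict. *)
Lemma rint_exposed y h : polar hcone y -> (hcone `&` perp [set y]) h ->
  exists2 s, (hcone `&` perp [set y]) s &
    forall c : R, 0 < c -> rint (hcone `&` perp [set y]) (c *: (h + s)).
Proof.
move=> Ky Fh; set F := hcone `&` perp [set y] in Fh *.
have cF : cone F by exact/cone_perp/cone_hcone.
have /choice[G HG] : forall i, exists g, F g /\
    ((exists2 g', F g' & dot (a i) g' < 0) -> dot (a i) g < 0).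
  move=> i.
  have [[g Fg gi]|ni] := pselect (exists2 g, F g & dot (a i) g < 0).
    by exists g.
  by exists 0; split=> //; exact: cF.1.
(* no inequality is violated at s, and every one not tight on F is strict there *)
set s := \sum_i G i.
have Fs : F s by apply: cone_sum => // i; exact: (HG i).1.
exists s => // c c0; pose g0 : 'cV[R]_d := c *: (h + s); rewrite -/g0.
have Fg0 : F g0 by apply: coneZ => //; [exact: ltW|exact: coneD].
split => //.
have strict i : (exists2 g, F g & dot (a i) g < 0) -> dot (a i) g0 < 0.
  move=> ex; rewrite /g0 dotZr pmulr_rlt0// dotDr /s dot_sumr (bigD1 i)//=.
  have := (HG i).2 ex; have := Fh.1 i.
  have : \sum_(j | j != i) dot (a i) (G j) <= 0.
    by apply: sumr_le0 => j _; exact: (HG j).1.1.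
  by lra.
have near_i i : \forall g \near g0, aff_hull F g -> dot (a i) g <= 0.
  have [/strict ex|ni] := pselect (exists2 g, F g & dot (a i) g < 0).
    have : \forall g \near g0, dot (a i) g < 0.
      exact: (cvgr_lt _ (@dot_continuous _ _ (a i) g0) _ ex).
    by apply: filterS => g /ltW.
  apply: filterE => g /(_ [set g | dot (a i) g = 0]) /= ->//.
  split=> [b u v /= u0 v0|g' Fg'].
    by rewrite dotDr !dotZr u0 v0 !mulr0 addr0.
  apply/le_anti; rewrite Fg'.1 /= leNgt; apply/negP => lt0.
  by apply: ni; exists g'.
have near_all : \forall g \near g0, forall i, aff_hull F g -> dot (a i) g <= 0.
  exact: (@filter_forall _ _ _ (nbhs g0) (nbhs_filter g0) near_i).
apply: filterS near_all => g Hg Ag; split=> [i|]; first exact: Hg.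
apply/perp1; apply: (Ag [set g | dot y g = 0]); split=> [b u v /= u0 v0|g' Fg'].
  by rewrite dotDr !dotZr u0 v0 !mulr0 addr0.
exact/perp1/Fg'.2.
Qed.

(** The inequalities that are tight on all of a set. *)
Definition tight_on (F : set 'cV[R]_d) : pred 'I_k :=
  fun i => `[< forall g, F g -> dot (a i) g = 0 >].

(** A strictly larger exposed face has strictly fewer identically tight
    inequalities. *)
Lemma card_tight_on y1 y2 : polar hcone y1 ->
  (hcone `&` perp [set y1]) `<=` (hcone `&` perp [set y2]) ->
  ~ ((hcone `&` perp [set y2]) `<=` (hcone `&` perp [set y1])) ->
  (#|tight_on (hcone `&` perp [set y2])| < #|tight_on (hcone `&` perp [set y1])|)%N.
Proof.
move=> Ky1 sub nsub; rewrite ltnNge; apply/negP => le; apply: nsub.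
have ss : tight_on (hcone `&` perp [set y2]) \subset
    tight_on (hcone `&` perp [set y1]).
  apply/fintype.subsetP => i /asboolP Hi; apply/asboolP => g Fg; apply: Hi; exact: sub.
have /subset_leqif_card := ss; case=> _; rewrite eqn_leq le subset_leq_card//.
move=> /esym/fintype.subsetP s12 g [Kg yg]; split=> //.
have [l [l0 yE]] := polar_hcone Ky1.
apply/perp1; rewrite yE dot_suml big1// => i _; rewrite dotZl.
have [->|li] := eqVneq (l i) 0; first by rewrite mul0r.
suff /s12/asboolP -> : i \in tight_on (hcone `&` perp [set y1]); rewrite ?mulr0//.
apply/asboolP => g' [Kg' /perp1]; rewrite yE dot_suml => /eqP.
rewrite -oppr_eq0 -sumrN psumr_eq0 => [|j _]; last first.
  by rewrite oppr_ge0 dotZl mulr_ge0_le0//; exact: Kg'.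
move=> /allP/(_ i (mem_index_enum _)); rewrite oppr_eq0 dotZl mulf_eq0.
by rewrite (negPf li) => /eqP.
Qed.

End PolyCone.

(** A cone that is a polyhedron is cut out by the homogeneous versions of the
    inequalities defining it. *)
Lemma polyhedral_cone (R : realType) (d : nat) (K : set 'cV[R]_d) :
  cone K -> polyhedral K ->
  exists k (a : 'I_k -> 'cV[R]_d), K = hcone a.
Proof.
move=> cK [k [M [v KE]]]; exists k, (fun i => (row i M)^T).
have dE i g : dot (row i M)^T g = (M *m g) i 0.
  by rewrite dotE mxE; apply: eq_bigr => j _; rewrite !mxE.
apply/seteqP; split=> g Hg; last first.
  rewrite KE => i /=; rewrite -dE (le_trans (Hg i))//.
  by have := cK.1; rewrite KE => /(_ i); rewrite mulmx0 mxE.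
move=> i; rewrite dE leNgt; apply/negP => gi.
(* scaling g by enough to break the inequality *)
have := coneZ (a := (`|v i 0| + 1) / (M *m g) i 0) cK _ Hg.
have -> : 0 <= (`|v i 0| + 1) / (M *m g) i 0 by rewrite divr_ge0 ?ltW// ltr_wpDl.
move=> /(_ isT); rewrite KE => /(_ i); rewrite -scalemxAr mxE divfK ?gt_eqF//.
by have := ler_norm (v i 0); lra.
Qed.

(** * Conic duality for linear matrix inequalities *)

Section Duality.
Context {R : realType}.

Lemma closed_ge0 (T : topologicalType) (I : Type) (f : I -> T -> R) :
  (forall i, continuous (f i)) -> closed [set x | forall i, 0 <= f i x].
Proof.
move=> cf.
have -> : [set x | forall i, 0 <= f i x]
    = \bigcap_(i in setT) (f i @^-1` [set t | 0 <= t]).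
  by apply/seteqP; split=> x /= Hx i; [move=> _|]; exact: Hx.
apply: closed_bigI => i _; apply: preimage_closed; last exact: closed_ge.
by move=> x _; exact: cf.
Qed.

Lemma lin_continuous k (f : 'rV[R]_k -> R) :
  (forall a u v, f (a *: u + v) = a * f u + f v) -> continuous f.
Proof.
move=> fl.
have f0 : f 0 = 0 by have := fl 1 0 0; rewrite scaler0 addr0 mul1r; lra.
have -> : f = fun w => \sum_i f (delta_mx 0 i) * w 0 i.
  apply/funext => w; rewrite {1}[w]row_sum_delta.
  by elim/big_rec2: _ => [|i x y _ <-]; rewrite ?f0// fl mulrC.
apply: sum_continuous => i; apply: mulc_continuous; exact: coord_continuous.
Qed.

(** A quadratic that vanishes at 0 and is nonnegative on ]0, 1] has nonnegative
    slope at 0. *)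
Lemma ge0_of_quad (b B : R) :
  (forall e, 0 < e <= 1 -> 0 <= 2 * e * b + e ^+ 2 * B) -> 0 <= b.
Proof.
move=> H; rewrite leNgt; apply/negP => b0.
have B1 : 0 < `|B| + 1 by rewrite ltr_wpDl.
have BB := ler_norm B.
pose e := Num.min 1 (- b / (`|B| + 1)).
have e0 : 0 < e by rewrite lt_min ltr01 divr_gt0// oppr_gt0.
have e1 : e <= 1 by rewrite ge_min lexx.
have eB : e * (`|B| + 1) <= - b by rewrite -ler_pdivlMr// ge_min lexx orbT.
have := H e; rewrite e0 e1 => /(_ isT).
have -> : 2 * e * b + e ^+ 2 * B = e * (2 * b + e * B) by ring.
rewrite pmulr_rge0//; apply/negP; rewrite -ltNge.
by have := ler_wpM2l (ltW e0) BB; lra.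
Qed.

Context {n : nat}.
Implicit Types (A Y Z : 'M[R]_n).

Lemma pd_unit A : pd A -> A \in unitmx.
Proof.
move=> [As Ap]; rewrite -row_free_unit -kermx_eq0; apply/eqP/row_matrixP => i.
rewrite row0; apply: trmx_inj; rewrite trmx0; apply/eqP/negPn/negP => /Ap.
have : row i (kermx A) *m A = 0 by apply/sub_kermxP; rewrite row_sub.
by move/(congr1 trmx); rewrite trmx_mul As trmx0 => ->; rewrite dot0r ltxx.
Qed.

(** A positive definite matrix bounds the diagonal of every positive
    semidefinite one: apply Cauchy-Schwarz for A to A^-1 e_i and the vectors of a
    rank-one decomposition. *)
Lemma pd_diag_bound A : pd A ->
  exists2 c : R, 0 <= c & forall Y, psd Y -> forall i, Y i i <= c * trdot A Y.
Proof.
move=> Apd; have Ap := pd_psd Apd; have Au := pd_unit Apd.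
pose w i : 'cV[R]_n := invmx A *m delta_mx i 0.
have Aw i : A *m w i = delta_mx i 0 by rewrite mulKVmx.
pose c := \sum_i dot (w i) (A *m w i).
have wc i : dot (w i) (A *m w i) <= c.
  by rewrite /c (bigD1 i)//= lerDl sumr_ge0// => j _; apply: Ap.2.
exists c; first by rewrite sumr_ge0// => i _; apply: Ap.2.
move=> Y /psd_decomp[s ->] i; rewrite summxE trdot_sumr mulr_sumr.
apply: ler_sum => v _; rewrite trdot_outer !mxE big_ord1 !mxE -expr2.
rewrite -dot_delta -Aw dotC (dot_sym _ _ Ap.1).
apply: le_trans (psd_cs _ _ Ap) _.
by apply: ler_wpM2r; [exact: Ap.2|exact: wc].
Qed.

Lemma psd_entry_bound Y (D : R) : psd Y -> (forall i, Y i i <= D) ->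
  forall i j, `|Y i j| <= D.
Proof.
move=> Yp YD i j.
have diag k : dot (delta_mx k 0) (Y *m delta_mx k 0) = Y k k.
  by rewrite dot_delta -colE mxE.
have Y0 k : 0 <= Y k k by rewrite -diag; apply: Yp.2.
have D0 : 0 <= D := le_trans (Y0 i) (YD i).
have := psd_cs (delta_mx i 0) (delta_mx j 0) Yp.
rewrite !diag dot_delta -colE mxE => h.
rewrite -(ler_pXn2r (n := 2)) ?nnegrE// real_normK ?num_real//.
by apply: le_trans h _; rewrite expr2 ler_pM.
Qed.

(** Positive definiteness is an open condition. *)
Lemma pd_perturb A (B : 'M[R]_n) : pd A -> B^T = B ->
  exists2 e : R, 0 < e & pd (A + e *: B).
Proof.
move=> Apd Bs; have Ap := pd_psd Apd; have [c c0 Hc] := pd_diag_bound Apd.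
pose S := \sum_i \sum_j `|B i j|.
have S0 : 0 <= S by apply: sumr_ge0 => i _; apply: sumr_ge0.
have BS x : - (S * (c * dot x (A *m x))) <= dot x (B *m x).
  have Hx := psd_entry_bound (psd_outer x) (Hc _ (psd_outer x)).
  rewrite trdot_outer in Hx.
  rewrite [leRHS]dotE /S mulr_suml -sumrN; apply: ler_sum => i _.
  rewrite mxE mulr_suml -sumrN mulr_sumr; apply: ler_sum => j _.
  have := Hx i j; rewrite !mxE big_ord1 !mxE => xij.
  rewrite [leRHS]mulrCA lerNl; apply: le_trans (ler_norm _) _.
  by rewrite normrN normrM ler_wpM2l.
have e1 : 0 < S * c + 1 by rewrite ltr_wpDl// mulr_ge0.
exists (S * c + 1)^-1; first by rewrite invr_gt0.
split; first by rewrite linearD linearZ /= Bs Ap.1.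
move=> x x0; rewrite mulmxDl -scalemxAl dotDr dotZr.
have q0 := Apd.2 x x0; set q := dot x (A *m x) in q0 *.
rewrite -(pmulr_rgt0 _ e1) mulrDr mulrA mulfV ?gt_eqF// mul1r.
by have := BS x; rewrite -/q; nra.
Qed.

(** Positive part. *)
Definition pos (a : R) : R := Num.max 0 a.

Lemma pos_ge0 a : 0 <= pos a.
Proof. by rewrite le_max lexx. Qed.

Lemma pos_ge a : a <= pos a.
Proof. by rewrite le_max lexx orbT. Qed.

Lemma posM a : pos a * a = pos a ^+ 2.
Proof. by rewrite /pos; case: (leP 0 a) => _; rewrite ?mul0r ?expr0n. Qed.

(** The quadratic upper model of the squared positive part at a. *)
Lemma pos_sqD a b : pos (a + b) ^+ 2 <= (pos a + b) ^+ 2.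
Proof.
rewrite {1}/pos; case: (leP 0 (a + b)) => ab; last by rewrite expr0n sqr_ge0.
by have := pos_ge a; nra.
Qed.

Lemma pos_sq_continuous (T : topologicalType) (f : T -> R) (c : R) :
  continuous f -> continuous (fun x => pos (f x + c) ^+ 2).
Proof.
move=> cf.
have ca : continuous (fun x => f x + c).
  by move=> x; apply: cvgD; [exact: cf|exact: cvg_cst].
have cp : continuous (fun x => pos (f x + c)).
  by move=> x; apply: (@continuous_max _ _ (fun=> 0) _ x);
    [exact: cst_continuous|exact: ca].
by move=> x; apply: cvgM; exact: cp.
Qed.

Lemma subc_continuous (T : topologicalType) (f : T -> R) (c : R) :
  continuous f -> continuous (fun x => c - f x).
Proof. by move=> cf x; apply: cvgB; [exact: cvg_cst|exact: cf]. Qed.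

Section Penalty.
Context {N : nat} (A : 'I_N -> 'M[R]_n) (r : 'cV[R]_N).

(** Squared violation of the linear matrix constraints. *)
Definition penalty Y : R := \sum_i pos (trdot (A i) Y + r i 0) ^+ 2.

(** A positive definite nonnegative combination makes the sublevel sets of the
    penalty bounded, so that it has a minimiser. *)
Lemma penalty_min (h : 'cV[R]_N) :
  (forall i, 0 <= h i 0) -> pd (\sum_i h i 0 *: A i) ->
  exists2 Y, psd Y & forall Z, psd Z -> penalty Y <= penalty Z.
Proof.
move=> h0 hpd; have [c c0 Hc] := pd_diag_bound hpd.
set C := penalty 0.
have C0 : 0 <= C by rewrite sumr_ge0// => i _; rewrite sqr_ge0.
pose D := c * (\sum_i h i 0 * (C + 1 - r i 0)).
have bound Y : psd Y -> penalty Y <= C -> forall i j, `|Y i j| <= D.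
  move=> Yp YC; apply: psd_entry_bound => // i.
  apply: le_trans (Hc Y Yp i) _; apply: ler_wpM2l => //.
  rewrite trdot_suml; apply: ler_sum => j _; rewrite trdotZl.
  apply: ler_wpM2l => //; rewrite lerBrDr; apply: le_trans (pos_ge _) _.
  have : pos (trdot (A j) Y + r j 0) ^+ 2 <= C.
    apply: le_trans YC; rewrite /penalty (bigD1 j)//= lerDl sumr_ge0// => l _.
    exact: sqr_ge0.
  by have := pos_ge0 (trdot (A j) Y + r j 0); nra.
(* matrices are flattened to row vectors *)
pose K : set 'rV[R]_(n * n) :=
  [set w | psd (vec_mx w) /\ penalty (vec_mx w) <= C].
have vecl (a : R) (u v : 'rV[R]_(n * n)) :
    vec_mx (a *: u + v) = a *: vec_mx u + vec_mx v :> 'M[R]_n.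
  by rewrite linearP.
have cpen : continuous (fun w : 'rV[R]_(n * n) => penalty (vec_mx w)).
  apply: sum_continuous => i; apply: pos_sq_continuous.
  by apply: lin_continuous => a u v; rewrite vecl trdotDr trdotZr.
have Kcl : closed K.
  have -> : K = [set w | forall x : 'cV[R]_n, 0 <= dot x (vec_mx w *m x)]
      `&` [set w | forall p : 'I_n * 'I_n, 0 <= vec_mx w p.1 p.2 - vec_mx w p.2 p.1]
      `&` [set w | forall _ : unit, 0 <= C - penalty (vec_mx w)].
    apply/seteqP; split=> w.
      move=> [[Ys Yp] YC]; split; last by move=> _; rewrite subr_ge0.
      by split=> //= -[i j] /=; rewrite -{1}Ys mxE subrr.
    move=> [[Yp Ys] YC]; split; last by rewrite -subr_ge0; exact: (YC tt).
    split=> //; apply/matrixP => i j; rewrite mxE; apply/le_anti.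
    by have := Ys (i, j); have := Ys (j, i); rewrite /= !subr_ge0 => -> ->.
  apply: closedI; first apply: closedI.
  - apply: closed_ge0 => x; apply: lin_continuous => a u v.
    by rewrite vecl mulmxDl -scalemxAl dotDr dotZr.
  - apply: closed_ge0 => -[i j]; apply: lin_continuous => a u v /=.
    by rewrite vecl !mxE; ring.
  - by apply: closed_ge0 => _; exact: subc_continuous.
have Kco : compact K.
  apply: (subclosed_compact Kcl (@rV_compact _ _ (fun=> `[- D, D]%classic) _)).
    by move=> _; exact: segment_compact.
  move=> w [Yp YC] j /=; rewrite in_itv /= -ler_norml.
  have [i1 [i2 ->]] : exists i1 i2, j = mxvec_index i1 i2.
    by case/mxvec_indexP: j => i1 i2; exists i1, i2.
  have := bound _ Yp YC i1 i2.
  by rewrite mxE.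
have K0 : K !=set0.
  by exists 0; rewrite /K /= linear0; split; [exact: psd0|rewrite lexx].
have [w /set_mem[Yp YC] Hw] := compact_EVT_min K0 Kco
  (continuous_subspaceT cpen).
exists (vec_mx w) => // Z Zp.
have [ZC|ZC] := leP (penalty Z) C; last exact: le_trans YC (ltW ZC).
by have := Hw (mxvec Z); rewrite mxvecK; apply; apply/mem_set; rewrite /K /= mxvecK.
Qed.

(** Conic duality for the linear matrix inequalities tr(A_i Y) + r_i <= 0 in a
    positive semidefinite unknown.  The residual g of a minimiser of the penalty
    is a dual feasible vector; pairing it with r shows that it vanishes. *)
Lemma sdp_duality (h : 'cV[R]_N) :
  (forall i, 0 <= h i 0) -> pd (\sum_i h i 0 *: A i) ->
  (forall g : 'cV[R]_N, (forall i, 0 <= g i 0) -> psd (\sum_i g i 0 *: A i) ->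
     dot r g <= 0) ->
  (forall i, (A i)^T = A i) ->
  exists2 Y, psd Y & forall i, trdot (A i) Y + r i 0 <= 0.
Proof.
move=> h0 hpd H As; have [Y Yp Ymin] := penalty_min h0 hpd.
exists Y => //.
pose a i := trdot (A i) Y + r i 0.
pose g : 'cV[R]_N := \col_i pos (a i).
have gE i : g i 0 = pos (a i) by rewrite mxE.
(* first-order optimality in a direction that is feasible for the cone *)
have dir Z : (forall e : R, 0 < e <= 1 -> psd (Y + e *: Z)) ->
    0 <= trdot (\sum_i g i 0 *: A i) Z.
  move=> HZ; apply: (@ge0_of_quad _ (\sum_i trdot (A i) Z ^+ 2)) => e e01.
  have := Ymin _ (HZ e e01); rewrite -subr_ge0 => h1; apply: le_trans h1 _.
  rewrite lerBlDr trdot_suml !mulr_sumr -!big_split /=; apply: ler_sum => i _.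
  rewrite trdotDr trdotZr addrAC; apply: le_trans (pos_sqD _ _) _.
  by rewrite -/(a i) gE trdotZl le_eqVlt; apply/orP; left; apply/eqP; ring.
have gp : psd (\sum_i g i 0 *: A i).
  split.
    by rewrite linear_sum; apply: eq_bigr => i _; rewrite linearZ /= As.
  move=> u; rewrite -trdot_outer; apply: dir => e /andP[e0 _].
  by apply: psdD => //; apply: psdZ; [exact: ltW|exact: psd_outer].
have gY : trdot (\sum_i g i 0 *: A i) Y <= 0.
  rewrite -oppr_ge0 -mulN1r -trdotZr; apply: dir => e /andP[e0 e1].
  have -> : Y + e *: (-1 *: Y) = (1 - e) *: Y.
    by rewrite scaleN1r scalerN scalerBl scale1r.
  by apply: psdZ => //; rewrite subr_ge0.
have rg : dot r g <= 0 by apply: H => // i; rewrite gE pos_ge0.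
have gg : dot g g = trdot (\sum_i g i 0 *: A i) Y + dot r g.
  rewrite trdot_suml !dotE -big_split /=; apply: eq_bigr => i _.
  by rewrite trdotZl gE (mulrC (r i 0)) -mulrDr -/(a i) posM expr2.
have g0 : g = 0.
  by apply: dot_eq0; apply/le_anti; rewrite dot_ge0 andbT gg addr_le0.
by move=> i; apply: le_trans (pos_ge _) _; rewrite -/(a i) -gE g0 mxE.
Qed.

End Penalty.
End Duality.

(** * Lagrangian residuals of a quadratic program *)

Section QCQP.
Context {R : realType} {n m : nat} (P : qcqp R n m).
Implicit Types (p d : xtspace R n) (g h : 'cV[R]_m.+1) (f : 'cV[R]_m).

Lemma hvec0 (c : R) f : hvec c f ord0 0 = c.
Proof.
transitivity ((c%:M : 'M[R]_1) 0 0); last by rewrite mxE eqxx mulr1n.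
rewrite -[RHS](@col_mxEu R 1 m 1 c%:M f ord0 0) /hvec.
congr (fun_of_matrix _ _ _); exact: val_inj.
Qed.

Lemma hvecS (c : R) f i : hvec c f (lift ord0 i) 0 = f i 0.
Proof.
rewrite -[RHS](@col_mxEd R 1 m 1 c%:M f i 0) /hvec.
congr (fun_of_matrix _ _ _); exact: val_inj.
Qed.

Lemma hvecE g : g ord0 0 = 1 -> g = hvec 1 (\col_i g (lift ord0 i) 0).
Proof.
move=> g1; apply/matrixP => i j; rewrite (ord1 j).
by case: (unliftP ord0 i) => [k ->|->]; rewrite ?hvecS ?hvec0// mxE.
Qed.

(** The homogeneous counterpart of the aggregated linear term. *)
Definition bhom g : 'cV[R]_n := \sum_i g i 0 *: qb P i.

Lemma Ahom_hvec f : Ahom P (hvec 1 f) = Aagg P f.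
Proof.
rewrite /Ahom big_ord_recl hvec0 scale1r; congr (_ + _).
by apply: eq_bigr => i _; rewrite hvecS.
Qed.

Lemma bhom_hvec f : bhom (hvec 1 f) = bagg P f.
Proof.
rewrite /bhom big_ord_recl hvec0 scale1r; congr (_ + _).
by apply: eq_bigr => i _; rewrite hvecS.
Qed.

Lemma AhomD (a b : R) g h :
  Ahom P (a *: g + b *: h) = a *: Ahom P g + b *: Ahom P h.
Proof.
rewrite /Ahom !scaler_sumr -big_split; apply: eq_bigr => i _.
by rewrite !mxE scalerDl !scalerA.
Qed.

Lemma bhomD (a b : R) g h : bhom (a *: g + b *: h) = a *: bhom g + b *: bhom h.
Proof.
rewrite /bhom !scaler_sumr -big_split; apply: eq_bigr => i _.
by rewrite !mxE scalerDl !scalerA.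
Qed.

Lemma cone_Gam : cone (Gam P).
Proof.
split; first split => [i|].
- by rewrite mxE.
- rewrite /Ahom big1; first exact: psd0.
  by move=> i _; rewrite mxE scale0r.
move=> a b g h a0 b0 [g0 gp] [h0 hp]; split.
  by move=> i; rewrite !mxE addr_ge0// mulr_ge0.
by rewrite AhomD; apply: psdD; apply: psdZ.
Qed.

Lemma Gam_hvec f : Gam P (hvec 1 f) <-> Gam1 P f.
Proof.
rewrite /Gam /Gam1 /= Ahom_hvec; split=> -[f0 fp]; split=> // i.
  by rewrite -(hvecS 1 f).
by case: (unliftP ord0 i) => [k ->|->]; rewrite ?hvecS ?hvec0.
Qed.

(** Normalising a multiplier with positive objective weight. *)
Lemma Gam_scale g : Gam P g -> 0 < g ord0 0 ->
  exists2 f, Gam1 P f & g = g ord0 0 *: hvec 1 f.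
Proof.
move=> Kg g0; pose g' := (g ord0 0)^-1 *: g.
have g'E : g' = hvec 1 (\col_i g' (lift ord0 i) 0).
  by apply: hvecE; rewrite mxE mulVf ?gt_eqF.
exists (\col_i g' (lift ord0 i) 0).
  apply/Gam_hvec; rewrite -g'E; apply: (coneZ cone_Gam) => //.
  by rewrite invr_ge0 ltW.
by rewrite -g'E scalerA mulfV ?gt_eqF// scale1r.
Qed.

(** The residual q(x) - 2 t e_0 of a point (x, t). *)
Definition residp p : 'cV[R]_m.+1 := resid P p.1 p.2.

(** The residual along a line is quadratic; these are its coefficients. *)
Definition resid1 p d : 'cV[R]_m.+1 :=
  \col_i (2 * (dot p.1 (qA P i *m d.1) + dot (qb P i) d.1)) - (2 * d.2) *: e0 R m.

Definition resid2 d : 'cV[R]_m.+1 := \col_i dot d.1 (qA P i *m d.1).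

Lemma residp_line p d (a : R) :
  residp (p + a *: d) = residp p + a *: resid1 p d + a ^+ 2 *: resid2 d.
Proof.
apply/matrixP => i j; rewrite !mxE /qval /=.
rewrite mulmxDr -!scalemxAr !dotDr !dotDl !dotZr !dotZl.
have -> : a *: d.2 = a * d.2 by [].
rewrite (dot_sym d.1 p.1 (qA_sym P i)).
by ring.
Qed.

Lemma dot_residp_line p d (a : R) g : dot (residp (p + a *: d)) g =
  dot (residp p) g + a * dot (resid1 p d) g + a ^+ 2 * dot (resid2 d) g.
Proof. by rewrite residp_line dotDl (dotDl (residp p)) !dotZl. Qed.

Lemma dot_e0 g : dot (e0 R m) g = g ord0 0.
Proof. exact: dot_delta. Qed.

Lemma dot_resid1 p d g : dot (resid1 p d) g =
  2 * (dot p.1 (Ahom P g *m d.1) + dot (bhom g) d.1 - g ord0 0 * d.2).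
Proof.
rewrite /resid1 dotBl dotZl dot_e0 dotE.
have -> : dot p.1 (Ahom P g *m d.1) = \sum_i g i 0 * dot p.1 (qA P i *m d.1).
  rewrite mulmx_suml dot_sumr; apply: eq_bigr => i _.
  by rewrite -scalemxAl dotZr.
have -> : dot (bhom g) d.1 = \sum_i g i 0 * dot (qb P i) d.1.
  by rewrite dot_suml; apply: eq_bigr => i _; rewrite dotZl.
rewrite mulrBr -big_split mulr_sumr; congr (_ - _); last by ring.
by apply: eq_bigr => i _; rewrite mxE /=; ring.
Qed.

Lemma dot_resid2 d g : dot (resid2 d) g = dot d.1 (Ahom P g *m d.1).
Proof.
rewrite mulmx_suml dot_sumr dotE; apply: eq_bigr => i _.
by rewrite -scalemxAl dotZr mxE mulrC.
Qed.

Lemma dot_resid2_ge0 d g : Gam P g -> 0 <= dot (resid2 d) g.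
Proof. by move=> [_ [_ gp]]; rewrite dot_resid2. Qed.

(** For g in Gam, this says that the pairing of the residual with g does not
    change along d ([flatP], [flat_line]). *)
Definition flat g d : Prop :=
  Ahom P g *m d.1 = 0 /\ dot (bhom g) d.1 = g ord0 0 * d.2.

Lemma flatP p d g : Gam P g ->
  flat g d <-> dot (resid1 p d) g = 0 /\ dot (resid2 d) g = 0.
Proof.
move=> Kg; rewrite dot_resid1 dot_resid2; split=> [[A0 b0]|[h1 h2]].
  by rewrite A0 b0 !dot0r add0r subrr mulr0.
have A0 := psd_ker Kg.2 h2; split=> //.
by move: h1; rewrite A0 dot0r; lra.
Qed.

Lemma flat_line p d g (a : R) : Gam P g -> flat g d ->
  dot (residp (p + a *: d)) g = dot (residp p) g.
Proof.
move=> Kg /(flatP p d Kg) [h1 h2].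
by rewrite dot_residp_line h1 h2 !mulr0 !addr0.
Qed.

Lemma residp_line_flat p d g : Gam P g ->
  (forall a, dot (residp (p + a *: d)) g = 0) -> flat g d.
Proof.
move=> Kg H; apply/(flatP p d Kg).
have h0 : dot (residp p) g = 0 by rewrite -(H 0) scale0r addr0.
have := H 1; have := H (-1).
rewrite (dot_residp_line p d (-1)) (dot_residp_line p d 1) h0 => h1 h2; split; lra.
Qed.

(** Positive semidefiniteness propagates the kernel of A[f] from a relative
    interior multiplier to the whole face. *)
Lemma dirsP (F : set 'cV[R]_m.+1) f d : cone F -> F `<=` Gam P ->
  rint F (hvec 1 f) -> dirs P F f d <-> forall g, F g -> flat g d.
Proof.
move=> cF FG rf; split=> [[Af bf] g Fg|H]; last first.
  split; first by rewrite -Ahom_hvec; apply: (H _ rf.1).1.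
  by move=> g Fg; rewrite -bhom_hvec (H _ Fg).2 hvec0 mul1r subrr.
split.
  apply: psd_ker; first exact: (FG _ Fg).2.
  have [e e0 /FG [_ [_ /(_ d.1)]]] := rint_sub rf Fg.
  rewrite scalerBr addrA -{1}[hvec 1 f]scale1r -scalerDl -scaleNr AhomD Ahom_hvec.
  rewrite mulmxDl -!scalemxAl Af scaler0 add0r dotZr => h.
  apply/le_anti; rewrite ((FG _ Fg).2.2 d.1) andbT.
  by move: h; rewrite mulNr oppr_ge0 pmulr_rle0.
have b1 h : F h -> h ord0 0 = 1 -> dot (bhom h) d.1 = d.2.
  move=> Fh h1; apply/eqP; rewrite -subr_eq0 (hvecE h1) bhom_hvec bf//.
  by rewrite -(hvecE h1).
have bF := b1 _ rf.1 (hvec0 1 f).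
have [g0|g0] := eqVneq (g ord0 0) 0.
  (* at infinity: translate the normalised multiplier by g *)
  have := b1 (1 *: hvec 1 f + 1 *: g); rewrite bhomD !scale1r dotDl bF g0 mul0r.
  move=> H; have : d.2 + dot (bhom g) d.1 = d.2.
    by apply: H; [exact: (coneD cF rf.1 Fg)|rewrite mxE hvec0 g0 addr0].
  by move=> H2; apply: (addrI d.2); rewrite H2 addr0.
have gp : 0 < g ord0 0 by rewrite lt_def g0; exact: (FG _ Fg).1.
have := b1 ((g ord0 0)^-1 *: g + 0 *: g).
rewrite bhomD (scale0r (bhom g)) addr0 dotZl scale0r addr0 => H.
rewrite -H; first by rewrite mulVKf.
  by apply: coneZ => //; rewrite invr_ge0 ltW.
by rewrite mxE mulVf.
Qed.

Lemma dot_residp_hvec p f : dot (residp p) (hvec 1 f) = qagg P f p.1 - 2 * p.2.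
Proof.
rewrite /residp /resid dotBl dotZl dot_e0 hvec0 mulr1; congr (_ - _).
rewrite dotE big_ord_recl hvec0 mulr1 mxE; congr (_ + _).
by apply: eq_bigr => i _; rewrite hvecS mxE mulrC.
Qed.

Lemma epi_sub_sdp : epi P `<=` sdp P.
Proof.
move=> p [h0 hi]; exists (p.1 *m p.1^T); split.
- by rewrite trmx_mul trmxK.
- by rewrite subrr; exact: psd0.
- by rewrite trdot_outer; exact: h0.
- by move=> i; rewrite trdot_outer; exact: hi.
Qed.

(** Aggregate the constraints of the relaxation with a multiplier in Gam. *)
Lemma sdp_polar p : sdp P p -> polar (Gam P) (residp p).
Proof.
move=> [X [Xs Xp h0 hi]] g [g0 gp].
have := trdot_psd_ge0 gp Xp.
pose a i := trdot (qA P i) X + 2 * dot (qb P i) p.1 + qc P i - 2 * p.2 * e0 R m i 0.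
have -> : dot (residp p) g = \sum_i g i 0 * a i - trdot (Ahom P g) (X - p.1 *m p.1^T).
  rewrite dotE trdot_suml -sumrB; apply: eq_bigr => i _.
  by rewrite trdotZl trdotBr trdot_outer /a !mxE /qval; ring.
have : \sum_i g i 0 * a i <= 0.
  apply: sumr_le0 => i _; apply: mulr_ge0_le0 => //; rewrite /a mxE.
  case: (unliftP ord0 i) => [j ->|->].
    by rewrite lift_eqF mulr0 subr0.
  by rewrite eqxx mulr1 subr_le0.
by lra.
Qed.

(** Conversely, X = Y + x x^T for the Y provided by conic duality. *)
Lemma polar_sdp p : (exists h, Gam P h /\ pd (Ahom P h)) ->
  polar (Gam P) (residp p) -> sdp P p.
Proof.
move=> [h [[h0 _] hpd]] Kp.
have [|Y Yp HY] := sdp_duality (r := residp p) h0 hpd _ (qA_sym P).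
  by move=> g g0 gp; apply: Kp; split.
have E i : trdot (qA P i) (Y + p.1 *m p.1^T) + 2 * dot (qb P i) p.1 + qc P i
    = trdot (qA P i) Y + residp p i 0 + 2 * p.2 * e0 R m i 0.
  by rewrite trdotDr trdot_outer !mxE /qval; ring.
exists (Y + p.1 *m p.1^T); split.
- by rewrite linearD /= Yp.1 (psd_outer _).1.
- by rewrite addrK.
- by rewrite E [e0 R m _ _]mxE !eqxx mulr1; have := HY ord0; lra.
- move=> i; rewrite E [e0 R m _ _]mxE lift_eqF mulr0 addr0.
  exact: HY.
Qed.

(** The residual is convex against every multiplier. *)
Lemma polar_residp_convex : @convex_set R _ [set p | polar (Gam P) (residp p)].
Proof.
apply/convex_setP => u v l /andP[l0 l1] Ku Kv g Kg.
have -> : l *: u + (1 - l) *: v = v + l *: (u - v).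
  by rewrite scalerBl scale1r scalerBr addrCA.
have ru : residp u = residp (v + 1 *: (u - v)) by rewrite scale1r addrC subrK.
have := Ku g Kg; have := Kv g Kg.
have := dot_resid2_ge0 (u - v) Kg.
rewrite ru (dot_residp_line v (u - v) 1) (dot_residp_line v (u - v) l).
set a0 := dot (residp v) g; set a1 := dot (resid1 _ _) g; set a2 := dot (resid2 _) g.
rewrite expr1n !mul1r => a20 v0 u0.
have -> : a0 + l * a1 + l ^+ 2 * a2
    = (1 - l) * a0 + l * (a0 + a1 + a2) - l * (1 - l) * a2 by ring.
have l1' : 0 <= 1 - l by rewrite subr_ge0 ltW.
rewrite subr_le0; apply: (@le_trans _ _ 0).
  by apply: addr_le0; apply: mulr_ge0_le0 => //; exact: ltW.
by rewrite !mulr_ge0// ltW.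
Qed.

End QCQP.

(** * Tightness, movement along flat directions, and exactness *)

Section Exactness.
Context {R : realType} {n m : nat} (P : qcqp R n m).
Implicit Types (p d : xtspace R n) (g h : 'cV[R]_m.+1) (f : 'cV[R]_m).

Local Notation face p := (Gam P `&` perp [set residp P p]).

Lemma tight_adherent p (e : R) : tight P p -> 0 < e ->
  exists2 f, Gam1 P f & - e < dot (residp P p) (hvec 1 f).
Proof.
move=> tp e0.
have [|_ [f Kf <-]] :=
  @ub_ereal_sup_adherent _ [set (qagg P f p.1)%:E | f in Gam1 P] e e0.
  by rewrite tp.
rewrite tp -EFinB lte_fin => lt; exists f => //.
by rewrite dot_residp_hvec; move: lt; lra.
Qed.

Lemma tight_intro p f : polar (Gam P) (residp P p) -> Gam1 P f ->
  dot (residp P p) (hvec 1 f) = 0 -> tight P p.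
Proof.
move=> Kp Kf; rewrite dot_residp_hvec => /eqP; rewrite subr_eq0 => /eqP qf.
apply/le_anti/andP; split.
  apply: ge_ereal_sup => _ [f' Kf' <-].
  rewrite lee_fin -subr_le0 -dot_residp_hvec.
  by apply: Kp; apply/Gam_hvec.
by rewrite -qf; apply: ereal_sup_ubound; exists f.
Qed.

Context {k : nat} (a : 'I_k -> 'cV[R]_m.+1).
Hypothesis Ka : Gam P = hcone a.

(** Polyhedrality makes the supremum defining tightness attained. *)
Lemma tight_attained p : tight P p -> polar (Gam P) (residp P p) ->
  exists2 h, face p h & h ord0 0 = 1.
Proof.
move=> tp Kp.
have [[h Fh h0]|none] := pselect (exists2 h, face p h & 0 < h ord0 0).
  exists ((h ord0 0)^-1 *: h); last by rewrite mxE mulVf ?gt_eqF.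
  by apply: coneZ => //; [exact/cone_perp/cone_Gam|rewrite invr_ge0 ltW].
have [|nu nu0 Kn] := @farkas_polar _ _ _ a (residp P p) (e0 R m).
  move=> g; rewrite -Ka => Kg pg; rewrite dot_e0 leNgt; apply/negP => g0.
  apply: none; exists g => //; split=> //; apply/perp1/le_anti.
  by rewrite pg andbT; exact: Kp.
have n1 : 0 < nu + 1 by rewrite ltr_wpDl.
have [|f Kf] := tight_adherent (e := (nu + 1)^-1) tp; first by rewrite invr_gt0.
have : dot (e0 R m + nu *: residp P p) (hvec 1 f) <= 0.
  by apply: Kn; rewrite -Ka; apply/Gam_hvec.
rewrite dotDl dotZl dot_e0 hvec0; set b := dot _ _ => h1 h2.
have : (nu + 1) * - (nu + 1)^-1 < (nu + 1) * b by rewrite ltr_pM2l.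
rewrite mulrN mulfV ?gt_eqF//.
have b0 : b <= 0 by apply: Kp; apply/Gam_hvec.
by lra.
Qed.

Lemma rint_face p : tight P p -> polar (Gam P) (residp P p) ->
  exists f, rint (face p) (hvec 1 f).
Proof.
move=> tp Kp; have [h Fh h1] := tight_attained tp Kp.
move: Kp Fh; rewrite Ka => Kp Fh; have [s Fs Hs] := rint_exposed Kp Fh.
have s0 : 0 <= s ord0 0.
  by have := Fs.1; rewrite -Ka => -[+ _]; apply.
have hs : 0 < (h + s) ord0 0 by rewrite mxE h1 ltr_wpDr.
have := Hs ((h + s) ord0 0)^-1; rewrite invr_gt0 => /(_ hs) rg.
exists (\col_i (((h + s) ord0 0)^-1 *: (h + s)) (lift ord0 i) 0).
by rewrite -hvecE// [LHS]mxE mulVf ?gt_eqF.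
Qed.

Lemma face_sub p : face p `<=` Gam P.
Proof. by move=> g []. Qed.

Lemma cone_face p : cone (face p).
Proof. exact/cone_perp/cone_Gam. Qed.

(** Both sets consist of the directions flat on the face of p. *)
Lemma Rprime_dirs p f :
  polar (Gam P) (residp P p) -> rint (Fface P p) (hvec 1 f) ->
  Rprime P p = dirs P (Fface P p) f.
Proof.
move=> Kp; have -> : Fface P p = face p by exact: perp_min_face (cone_Gam P) Kp.
move=> rf; apply/seteqP; split=> d.
  move=> Rd; apply/(dirsP d (cone_face p) (@face_sub p) rf) => g [Kg /perp1 pg].
  apply: (@residp_line_flat _ _ _ _ p) => // b.
  move: Kp (Rd b) Kg; rewrite /Gface Ka => Kp /(span_min_face _ Kp) H Kg.
  exact: H.
move/(dirsP d (cone_face p) (@face_sub p) rf) => Hd b.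
move: (Kp); rewrite /Gface Ka => Kp'; apply/(span_min_face _ Kp') => g.
rewrite -Ka => Kg pg; change (dot (residp P (p + b *: d)) g = 0).
by rewrite flat_line//; apply: Hd; split=> //; apply/perp1.
Qed.

(** A small step along a direction that is flat on the face stays feasible. *)
Lemma feasible_step p d : polar (Gam P) (residp P p) ->
  (forall g, face p g -> flat P g d) ->
  exists2 e : R, 0 < e & polar (Gam P) (residp P (p + e *: d)).
Proof.
move=> Kp Hd.
have F g : hcone a g -> dot (residp P p) g = 0 ->
    dot (resid1 P p d) g = 0 /\ dot (resid2 P d) g = 0.
  rewrite -Ka => Kg pg; apply/flatP => //.
  by apply: Hd; split=> //; apply/perp1.
have Kp' := Kp; rewrite Ka in Kp'.
have [e1 e10 H1] := polar_move Kp' (fun g Kg pg => (F g Kg pg).1).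
have [e2 e20 H2] := polar_move Kp' (fun g Kg pg => (F g Kg pg).2).
pose e := Num.min 1 (Num.min (e1 / 2) (e2 / 2)).
have e_gt0 : 0 < e by rewrite !lt_min ltr01 !divr_gt0.
have e_1 : e <= 1 by rewrite ge_min lexx.
have e_e1 : e <= e1 / 2 by rewrite /e !ge_min lexx orbT.
have e_e2 : e <= e2 / 2 by rewrite /e !ge_min lexx !orbT.
exists e => // g Kg; rewrite dot_residp_line.
have K1 : polar (hcone a) (residp P p + (2 * e) *: resid1 P p d).
  by apply: H1; rewrite gtr0_norm ?mulr_gt0//; lra.
have K2 : polar (hcone a) (residp P p + (2 * e ^+ 2) *: resid2 P d).
  apply: H2; rewrite gtr0_norm ?mulr_gt0 ?exprn_gt0//.
  have : e ^+ 2 <= e by rewrite expr2 ler_piMl// ltW.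
  by lra.
have := K1 g; have := K2 g; rewrite -Ka => /(_ Kg) + /(_ Kg).
by rewrite !(dotDl (residp P p)) !dotZl; lra.
Qed.

Lemma quad_continuous (c0 c1 c2 : R) :
  continuous (fun t : R => c0 + t * c1 + t ^+ 2 * c2).
Proof.
move=> t; apply: cvgD; [apply: cvgD; first exact: cvg_cst|].
  by apply: cvgM; [exact: cvg_id|exact: cvg_cst].
by apply: cvgM; [exact: exprn_continuous|exact: cvg_cst].
Qed.

(* A multiplier witnessing strict feasibility. *)
Context (h : 'cV[R]_m.+1) (Kh : Gam P h) (hpd : pd (Ahom P h)).

(** Following a nonzero flat direction as far as feasibility permits lands on a
    tight point whose face is strictly larger. *)
Lemma boundary_step p d f : polar (Gam P) (residp P p) ->
  rint (face p) (hvec 1 f) -> dirs P (face p) f d -> d <> 0 ->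
  exists t : R, [/\ 0 < t, polar (Gam P) (residp P (p + t *: d)),
    tight P (p + t *: d), face p `<=` face (p + t *: d)
    & ~ (face (p + t *: d) `<=` face p)].
Proof.
move=> Kp rf dd dn0.
have Hd := (dirsP d (cone_face p) (@face_sub p) rf).1 dd.
have d1 : d.1 != 0.
  apply/eqP => d10; apply: dn0; have [_ /(_ f rf.1)] := dd.
  rewrite d10 dot0r sub0r => /eqP; rewrite oppr_eq0 => /eqP d20.
  by move: d10 d20; case: (d) => x y /= -> ->.
pose T := [set t : R | 0 <= t /\ polar (Gam P) (residp P (p + t *: d))].
have Tcl : closed T.
  have -> : T = [set t | forall _ : unit, 0 <= t] `&`
      [set t | forall g : {g | Gam P g}, 0 <= - dot (residp P p) (sval g)
        + t * - dot (resid1 P p d) (sval g)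
        + t ^+ 2 * - dot (resid2 P d) (sval g)].
    apply/seteqP; split=> t [t0 Ht]; split=> //=.
    - move=> [g Kg] /=; have := Ht g Kg; rewrite dot_residp_line; lra.
    - exact: t0 tt.
    - by move=> g Kg; have := Ht (exist _ g Kg); rewrite dot_residp_line /=; lra.
  apply: closedI; apply: closed_ge0; last by move=> g; exact: quad_continuous.
  by move=> _ t; exact: cvg_id.
(* pairing with the positive definite multiplier h bounds T *)
pose c0 := dot (residp P p) h; pose c1 := dot (resid1 P p d) h.
pose c2 := dot (resid2 P d) h.
have c2_gt0 : 0 < c2 by rewrite /c2 dot_resid2; exact: hpd.2.
pose B := (`|c0| + `|c1|) / c2 + 1.
have TB t : T t -> t <= B.
  move=> [t0 /(_ h Kh)]; rewrite dot_residp_line -/c0 -/c1 -/c2 => Ht.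
  rewrite leNgt; apply/negP => Bt.
  have B1 : 1 <= B.
    by rewrite lerDr; apply: divr_ge0; [exact: addr_ge0|exact: ltW].
  have t1 : 1 < t := le_lt_trans B1 Bt.
  have tc : `|c0| + `|c1| < t * c2.
    by rewrite -ltr_pdivrMr//; apply: lt_trans Bt; rewrite ltrDl.
  have := ler_norm (- c0); have := ler_norm (- c1); rewrite !normrN => n1 n0.
  have : t * (`|c0| + `|c1|) < t * (t * c2).
    by rewrite ltr_pM2l// (lt_trans ltr01).
  have : t * - c1 <= t * `|c1| by rewrite ler_wpM2l.
  have : `|c0| <= t * `|c0| by rewrite ler_peMl// ltW.
  by lra.
have Tco : compact T.
  apply: (subclosed_compact Tcl (@segment_compact _ 0 B)).
  by move=> t Tt; rewrite /= in_itv /= (TB _ Tt) andbT; case: Tt.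
have T0 : T 0 by split=> //; rewrite scale0r addr0.
have [|t /set_mem[t0 Kt] tmax] := @compact_EVT_max _ R id _ (ex_intro _ 0 T0) Tco.
  by apply: continuous_subspaceT => ?; exact: cvg_id.
have sub : face p `<=` face (p + t *: d).
  move=> g Fg; split; first exact: Fg.1.
  apply/perp1; rewrite flat_line; [exact/perp1/Fg.2|exact: Fg.1|exact: Hd].
have tgt : 0 < t.
  have [e e0 Ke] := feasible_step Kp Hd.
  apply: lt_le_trans (e0) _; apply: tmax; apply/mem_set.
  by split; [exact: ltW|exact: Ke].
exists t; split=> //.
  (* f still attains the dual bound at the endpoint *)
  have Ff := sub _ rf.1; apply: (@tight_intro _ f) => //.
    by apply/Gam_hvec; exact: Ff.1.
  exact/perp1/Ff.2.
(* if the face were unchanged, one could go further *)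
move=> sub'; have [e e0 Ke] := feasible_step Kt (fun g Fg => Hd g (sub' g Fg)).
have : t + e <= t.
  apply: tmax; apply/mem_set; split; first by rewrite addr_ge0 ?ltW.
  by rewrite scalerDl addrA.
by rewrite gerDl leNgt e0.
Qed.

Hypothesis h0_1 : h ord0 0 = 1.

Lemma sdp_iff p : sdp P p <-> polar (Gam P) (residp P p).
Proof. by split; [exact: sdp_polar|apply: polar_sdp; exists h]. Qed.

Lemma sdp_convex : @convex_set R _ (sdp P).
Proof.
have -> : sdp P = [set p | polar (Gam P) (residp P p)].
  by apply/seteqP; split=> p /sdp_iff.
exact: polar_residp_convex.
Qed.

Lemma conv_sub_sdp : conv_hull (epi P) `<=` sdp P.
Proof. by apply: conv_hull_sub; [exact: epi_sub_sdp|exact: sdp_convex]. Qed.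

(** The convex hull of an epigraph is closed upwards. *)
Lemma conv_up p (s : R) : 0 <= s -> conv_hull (epi P) p ->
  conv_hull (epi P) (p + ((0 : 'cV[R]_n), s : R^o)).
Proof.
move=> s0; move: p; apply: (@conv_hull_sub _ _ (epi P)
    [set p | conv_hull (epi P) (p + ((0 : 'cV[R]_n), s : R^o))]).
  move=> p [h0 hi]; apply: sub_conv_hull; split => /=; rewrite addr0//.
  by apply: le_trans h0 _; rewrite ler_pM2l// lerDl.
apply/convex_setP => u v l l01 Hu Hv /=.
have := (convex_setP _).1 (convex_conv_hull (S := epi P)) _ _ l l01 Hu Hv.
set e := (0, _); suff -> : l *: (u + e) + (1 - l) *: (v + e)
  = l *: u + (1 - l) *: v + e by [].
by rewrite !scalerDr addrACA -scalerDl [l + _]addrC subrK scale1r.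
Qed.

(** Lowering t to the value of the dual bound gives a tight feasible point. *)
Lemma tight_below p : sdp P p ->
  exists2 s : R, 0 <= s &
    tight P (p - ((0 : 'cV[R]_n), s : R^o)) /\
    sdp P (p - ((0 : 'cV[R]_n), s : R^o)).
Proof.
move=> /sdp_iff Kp.
set E := ereal_sup [set (qagg P f p.1)%:E | f in Gam1 P].
have Eub : (E <= (2 * p.2)%:E)%E.
  apply: ge_ereal_sup => _ [f Kf <-]; rewrite lee_fin -subr_le0 -dot_residp_hvec.
  by apply: Kp; apply/Gam_hvec.
have hE := hvecE h0_1.
have Elb : ((qagg P (\col_i h (lift ord0 i) 0) p.1)%:E <= E)%E.
  apply: ereal_sup_ubound; exists (\col_i h (lift ord0 i) 0) => //.
  by apply/Gam_hvec; rewrite -hE.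
have Efin : E \is a fin_num.
  by rewrite fin_numElt (lt_le_trans (ltNyr _) Elb) (le_lt_trans Eub (ltry _)).
have EE : E = (fine E)%:E by rewrite fineK.
exists (p.2 - fine E / 2).
  by move: Eub; rewrite EE lee_fin; lra.
have p2 : 2 * (p - (0, p.2 - fine E / 2 : R^o)).2 = fine E.
  by rewrite /=; field.
have p1 : (p - ((0 : 'cV[R]_n), p.2 - fine E / 2 : R^o)).1 = p.1.
  by rewrite /= subr0.
split; first by rewrite /tight p1 p2 -EE.
apply/sdp_iff => g Kg.
have [g0|g0] := eqVneq (g ord0 0) 0.
  by have := Kp g Kg; rewrite /residp /resid p1 !dotBl !dotZl dot_e0 g0 !mulr0.
have gp : 0 < g ord0 0 by rewrite lt_def g0; exact: Kg.1.
have [f Kf ->] := Gam_scale Kg gp.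
rewrite dotZr mulr_ge0_le0 ?(ltW gp)// dot_residp_hvec p1 p2 subr_le0 -lee_fin -EE.
by apply: ereal_sup_ubound; exists f.
Qed.

(** Induction on the number of inequalities of Gam that are tight on the face. *)
Lemma conv_tight p : (forall F, tested_face P F ->
    exists f, rint F (hvec 1 f) /\ dirs P F f <> [set 0]) ->
  sdp P p -> tight P p -> conv_hull (epi P) p.
Proof.
move=> Htest.
have [N] := ubnP #|tight_on a (hcone a `&` perp [set residp P p])|.
elim: N p => // N IH p cardp Sp tp.
have [Ep|nEp] := pselect (epi P p); first exact: sub_conv_hull.
have Kp := (sdp_iff p).1 Sp.
have [|f [rf Hd]] := Htest (face p).
  split; last by exists p.
  exact: face_perp (cone_Gam P) Kp.
have cD := dirsP _ (cone_face p) (@face_sub p) rf.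
have [d dd dn0] : exists2 d, dirs P (face p) f d & d <> 0.
  apply: contrapT => none; apply: Hd; apply/seteqP; split=> [d dd|_ ->].
    by apply: contrapT => dn0; apply: none; exists d.
  by apply/cD => g _; split; rewrite ?mulmx0// dot0r mulr0.
have step d' : dirs P (face p) f d' -> d' <> 0 ->
    exists2 t : R, 0 < t & conv_hull (epi P) (p + t *: d').
  move=> dd' dn0'; have [t [t0 Kt tt sub nsub]] := boundary_step Kp rf dd' dn0'.
  exists t => //; apply: IH => //; last exact/sdp_iff.
  move: (cardp); rewrite ltnS; apply: leq_trans.
  by apply: card_tight_on; rewrite -Ka.
have [t t0 Ct] := step d dd dn0.
have [||s s0 Cs] := step (- d).
- apply/cD => g Fg; have [A0 b0] := (cD d).1 dd g Fg.
  by split; rewrite /= ?mulmxN ?A0 ?oppr0// dotNr b0 mulrN.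
- by move/eqP; rewrite oppr_eq0 => /eqP.
have ts : 0 < s + t by rewrite addr_gt0.
have := (convex_setP _).1 (convex_conv_hull (S := epi P)) _ _ (s / (s + t)) _ Ct Cs.
suff -> : s / (s + t) *: (p + t *: d) + (1 - s / (s + t)) *: (p + s *: - d) = p.
  apply; rewrite divr_gt0//= ltr_pdivrMr// mul1r ltrDl//.
rewrite !scalerDr addrACA -scalerDl [_ + (1 - _)]addrC subrK scale1r.
rewrite !scalerN !scalerA -scalerBl.
have -> : s / (s + t) * t - (1 - s / (s + t)) * s = 0.
  by field; rewrite gt_eqF.
by rewrite scale0r addr0.
Qed.

Lemma conv_of_test : (forall F, tested_face P F ->
    exists f, rint F (hvec 1 f) /\ dirs P F f <> [set 0]) ->
  conv_hull (epi P) = sdp P.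
Proof.
move=> Htest; apply/seteqP; split=> [|p Sp]; first exact: conv_sub_sdp.
have [s s0 [ts Ss]] := tight_below Sp.
by have := conv_up s0 (conv_tight Htest Ss ts); rewrite subrK.
Qed.

Lemma test_of_conv F : conv_hull (epi P) = sdp P -> tested_face P F ->
  exists f, rint F (hvec 1 f) /\ dirs P F f <> [set 0].
Proof.
move=> CS [_ [p [Sp nEp tp ->]]]; have Kp := (sdp_iff p).1 Sp.
have [f rf] := rint_face tp Kp; exists f; split; first exact: rf.
move: Sp; rewrite -CS => /conv_hull_not_extreme /(_ nEp).
move=> [u [v [l [Cu Cv /andP[l0 l1] uv pE]]]].
move=> D0; apply: uv; apply/eqP; rewrite -subr_eq0; apply/eqP.
have uE : u = p + (1 - l) *: (u - v).
  rewrite pE scalerBr addrACA addrN addr0 -scalerDl [l + _]addrC subrK.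
  by rewrite scale1r.
have vE : v = p + (- l) *: (u - v).
  rewrite pE scalerBr addrAC !scaleNr opprK addrA addrN add0r scalerBl scale1r.
  by rewrite addrC subrK.
suff : dirs P (face p) f (u - v) by rewrite D0.
apply/(dirsP _ (cone_face p) (@face_sub p) rf) => g [Kg /perp1 pg].
apply/(flatP p _ Kg).
(* the quadratic in the step is nonpositive at 1 - l and at - l and vanishes at 0 *)
have r2 := dot_resid2_ge0 (u - v) Kg.
have Ku := (sdp_iff u).1; rewrite -CS in Ku; have {Ku} := Ku Cu g Kg.
have Kv := (sdp_iff v).1; rewrite -CS in Kv; have {Kv} := Kv Cv g Kg.
rewrite {1}uE {1}vE (dot_residp_line P p (u - v) (1 - l)).
rewrite (dot_residp_line P p (u - v) (- l)) pg.
set r1 := dot (resid1 _ _ _) _; set c := dot (resid2 _ _) _ in r2 *.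
have l1' : 0 < 1 - l by rewrite subr_gt0.
have -> : 0 + - l * r1 + (- l) ^+ 2 * c = l * (l * c - r1) by ring.
have -> : 0 + (1 - l) * r1 + (1 - l) ^+ 2 * c = (1 - l) * (r1 + (1 - l) * c).
  by ring.
rewrite !pmulr_rle0// => h1 h2.
have c0 : c = 0 by apply/le_anti; rewrite r2 andbT; lra.
by split=> //; move: h1 h2; rewrite c0; lra.
Qed.

End Exactness.

(** The strict multiplier may be taken with objective weight one. *)
Lemma strict_normalised (R : realType) (n m : nat) (P : qcqp R n m) :
  (exists h, Gam P h /\ pd (Ahom P h)) ->
  exists h, [/\ Gam P h, pd (Ahom P h) & h ord0 0 = 1].
Proof.
move=> [h [[h0 hp] hpd]]; have [e e_gt0 epd] := pd_perturb hpd (qA_sym P ord0).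
pose h' := 1 *: h + e *: e0 R m.
have h'A : Ahom P h' = Ahom P h + e *: qA P ord0.
  rewrite /h' AhomD scale1r; congr (_ + e *: _).
  rewrite /Ahom (bigD1 ord0)//= mxE !eqxx scale1r big1 ?addr0// => i i0.
  by rewrite mxE (negPf i0) scale0r.
have h'0 : 0 < h' ord0 0.
  by rewrite !mxE !eqxx mulr1 mul1r ltr_wpDl.
have Kh' : Gam P h'.
  split; last by rewrite h'A; exact: pd_psd.
  by move=> i; rewrite !mxE mul1r addr_ge0// mulr_ge0// ltW.
exists ((h' ord0 0)^-1 *: h'); split; last by rewrite mxE mulVf ?gt_eqF.
  by apply: coneZ => //; [exact: cone_Gam|rewrite invr_ge0 ltW].
have -> : Ahom P ((h' ord0 0)^-1 *: h') = (h' ord0 0)^-1 *: Ahom P h'.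
  by rewrite -[X in Ahom P X]addr0 -(scale0r h') AhomD scale0r addr0.
rewrite h'A; split; first by rewrite linearZ /= epd.1.
by move=> x x0; rewrite -scalemxAl dotZr mulr_gt0 ?invr_gt0//; exact: epd.2.
Qed.

Theorem theorem3 (R : realType) (n m : nat) (n_gt0 : (0 < n)%N)
    (m_gt0 : (0 < m)%N) (P : qcqp R n m)
    (Gam_strict : exists h : 'cV[R]_m.+1, Gam P h /\ pd (Ahom P h))
    (Gam_poly : polyhedral (Gam P)) :
  (forall (p : xtspace R n) (f : 'cV[R]_m),
      sdp P p -> tight P p -> rint (Fface P p) (hvec 1 f) ->
      Rprime P p = dirs P (Fface P p) f) /\
  (forall F : set 'cV[R]_m.+1, tested_face P F ->
      (exists f : 'cV[R]_m, rint F (hvec 1 f)) /\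
      (forall f f' : 'cV[R]_m, rint F (hvec 1 f) -> rint F (hvec 1 f') ->
         dirs P F f = dirs P F f')) /\
  (conv_hull (epi P) = sdp P <->
    forall F : set 'cV[R]_m.+1, tested_face P F ->
      exists f : 'cV[R]_m, rint F (hvec 1 f) /\ dirs P F f <> [set 0]).
Proof.
have [k [a Ka]] := polyhedral_cone (cone_Gam P) Gam_poly.
have [h [Kh hpd h1]] := strict_normalised Gam_strict.
split; [|split; [|split]].
- move=> p f Sp _ rf; apply: (Rprime_dirs Ka) rf; exact: sdp_polar.
- move=> F [_ [p [Sp _ tp ->]]]; split.
    apply: (rint_face Ka) => //; exact: sdp_polar.
  move=> f f' rf rf'; apply/seteqP; split=> d dd.
    apply/(dirsP _ (cone_face P p) (@face_sub _ _ _ P p) rf').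
    exact/(dirsP _ (cone_face P p) (@face_sub _ _ _ P p) rf).
  apply/(dirsP _ (cone_face P p) (@face_sub _ _ _ P p) rf).
  exact/(dirsP _ (cone_face P p) (@face_sub _ _ _ P p) rf').
- by move=> CS F; exact: (test_of_conv Ka Kh hpd).
- exact: (conv_of_test Ka Kh hpd h1).
Qed.
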